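(* Let $X\in\mathbb{R}^{n\times p}$ have independent entries $X_{ai}\sim\mathrm{N}(M_{ai},1)$, where $M\in\mathbb{R}^{n\times p}$ is an unknown mean matrix. Let $h(X)=H(\lambda)$ be an orthogonally invariant function, where $\lambda=(\lambda_1,\dots,\lambda_p)$ are the eigenvalues of $X^{\top}X$. Then, the matrix quadratic risk of the estimator $\hat{M}=X+\widetilde{\nabla}h(X)$ is given by $$\mathrm{E}_M\left[(\hat{M}-M)^{\top}(\hat{M}-M)\right]=nI_p+\mathrm{E}_M\left[VDV^{\top}\right],$$ where $X^{\top}X=V\Lambda V^{\top}$ is a spectral decomposition of $X^{\top}X$, with $V$ orthogonal and $\Lambda=\mathrm{diag}(\lambda_1,\dots,\lambda_p)$, and $D$ is the $p\times p$ diagonal matrix given by $$D_{kk}=4\left(2\lambda_k\frac{\partial^2H}{\partial\lambda_k^2}+n\frac{\partial H}{\partial\lambda_k}+\lambda_k\left(\frac{\partial H}{\partial\lambda_k}\right)^2+\sum_{l\ne k}\frac{\lambda_l}{\lambda_k-\lambda_l}\left(\frac{\partial H}{\partial\lambda_k}-\frac{\partial H}{\partial\lambda_l}\right)\right).$$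
   Context: A function $h$ on $\mathbb{R}^{n\times p}$ is orthogonally invariant if $h(PXQ)=h(X)$ for any orthogonal matrices $P\in O(n)$ and $Q\in O(p)$; such a function can be written as $h(X)=H(\lambda)$, where $\lambda$ is the vector of eigenvalues of $X^{\top}X$. The matrix gradient $\widetilde{\nabla}h$ is the $n\times p$ matrix with $(\widetilde{\nabla}h(X))_{ai}=\partial h(X)/\partial X_{ai}$. The symbol $\mathrm{E}_M$ denotes expectation (entrywise for matrices) when $X$ has independent entries $X_{ai}\sim\mathrm{N}(M_{ai},1)$. The matrix quadratic loss is $L(M,\hat M)=(\hat M-M)^{\top}(\hat M-M)$, and the matrix quadratic risk is $\mathrm{E}_M[L(M,\hat M(X))]$. The indices $k,l$ run from $1$ to $p$.
   Formalization: The formal theorem assumes h is twice differentiable almost everywhere, its gradient is weakly differentiable and square-integrable, and the second derivatives used are integrable; the claim fails for h(x)=|x|. Eigenvalues are in nonincreasing order and 0/0 terms (only if p>n+1) are read as 0. *)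

(* Defs.v *)
From HB Require Import structures.
From mathcomp Require Import all_boot all_order all_algebra.
From mathcomp Require Import all_classical all_reals all_analysis.

Set Implicit Arguments.
Unset Strict Implicit.
Unset Printing Implicit Defensive.
Import Order.TTheory GRing.Theory Num.Theory.
Import numFieldNormedType.Exports.

Local Open Scope classical_set_scope.
Local Open Scope ring_scope.

Definition orthogonal_mx (R : realType) (n : nat) (Q : 'M[R]_n) : Prop :=
  Q^T *m Q = 1%:M.

Definition orthogonally_invariant (R : realType) (n p : nat)
    (h : 'M[R]_(n, p) -> R) : Prop :=
  forall (P : 'M[R]_n) (Q : 'M[R]_p) (X : 'M[R]_(n, p)),
    orthogonal_mx P -> orthogonal_mx Q -> h (P *m X *m Q) = h X.

(* The eigenvalues are listed in nonincreasing order, which makes the vector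
   [l] a function of [S]; no symmetry of a function of [l] is then needed. *)
Definition spectral_decomposition (R : realType) (p : nat)
    (S V : 'M[R]_p) (l : 'rV[R]_p) : Prop :=
  [/\ orthogonal_mx V, S = V *m diag_mx l *m V^T &
      forall i j : 'I_p, (i <= j)%N -> l 0 j <= l 0 i].

Definition mgrad (R : realType) (n p : nat) (h : 'M[R]_(n, p) -> R)
    (X : 'M[R]_(n, p)) : 'M[R]_(n, p) :=
  \matrix_(a, i) 'D_(delta_mx a i) h X.

Definition pderiv (R : realType) (p : nat) (H : 'rV[R]_p -> R) (k : 'I_p)
    (l : 'rV[R]_p) : R :=
  'D_(delta_mx 0 k) H l.

(* Division by zero, i.e. repeated eigenvalues, only matters almost surely
   when [p > n + 1], for the pairs [k], [j] with [l 0 k = l 0 j = 0]; the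
   convention [x / 0 = 0] makes the corresponding terms vanish. *)
Definition Ddiag (R : realType) (n p : nat) (H : 'rV[R]_p -> R)
    (l : 'rV[R]_p) : 'rV[R]_p :=
  \row_k (4 * (2 * l 0 k * pderiv (pderiv H k) k l
               + n%:R * pderiv H k l
               + l 0 k * pderiv H k l ^+ 2
               + \sum_(j < p | j != k)
                   l 0 j / (l 0 k - l 0 j) * (pderiv H k l - pderiv H j l))).

Definition mxqloss (R : realType) (n p : nat) (M Mhat : 'M[R]_(n, p))
    : 'M[R]_p :=
  (Mhat - M)^T *m (Mhat - M).

Definition mutually_independent (d : measure_display) (T : measurableType d)
    (R : realType) (P : probability T R) (I : finType) (X : I -> T -> R)
    : Prop :=
  forall (J : {set I}) (B : I -> set R), (forall i, measurable (B i)) ->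
    P (\bigcap_(i in [set` J]) X i @^-1` B i) =
    (\big[*%E/1]_(i in J) P (X i @^-1` B i))%E.

Definition independent_normal (d : measure_display) (T : measurableType d)
    (R : realType) (P : probability T R) (n p : nat) (M : 'M[R]_(n, p))
    (X : 'I_n -> 'I_p -> {RV P >-> R}) : Prop :=
  mutually_independent P (fun ai : 'I_n * 'I_p => X ai.1 ai.2 : T -> R) /\
  forall (a : 'I_n) (i : 'I_p) (A : set R), measurable A ->
    distribution P (X a i) A = normal_prob (M a i) 1 A.

Definition random_mx (d : measure_display) (T : measurableType d)
    (R : realType) (P : probability T R) (n p : nat)
    (X : 'I_n -> 'I_p -> {RV P >-> R}) (w : T) : 'M[R]_(n, p) :=
  \matrix_(a, i) X a i w.

Definition borel_mx (R : realType) (n p : nat) :=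
  g_sigma_algebraType (@open 'M[R]_(n, p)).

(* Under [independent_normal] the law of [random_mx X] has a positive density
   with respect to Lebesgue measure, so that this is the usual
   "for Lebesgue-almost every matrix". *)
Definition law_ae (d : measure_display) (T : measurableType d)
    (R : realType) (P : probability T R) (n p : nat)
    (X : 'I_n -> 'I_p -> {RV P >-> R}) (Q : 'M[R]_(n, p) -> Prop) : Prop :=
  {ae pushforward P (random_mx X : T -> borel_mx R n p), forall x, Q x}.

Definition twice_differentiable (R : realType) (n p : nat)
    (h : 'M[R]_(n, p) -> R) (x : 'M[R]_(n, p)) : Prop :=
  (\forall y \near x, differentiable h y) /\ differentiable (mgrad h) x.

(* [u |-> f (x + u *: v)] is locally absolutely continuous, i.e. it is the
   indefinite Lebesgue integral of its derivative. *)
Definition line_abs_continuous (R : realType) (n p : nat)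
    (f : 'M[R]_(n, p) -> R) (v x : 'M[R]_(n, p)) : Prop :=
  forall s t : R, s <= t ->
    (@lebesgue_measure R).-integrable `[s, t]
      (fun u => ('D_v f (x + u *: v))%:E) /\
    f (x + t *: v) - f (x + s *: v) =
      \int[@lebesgue_measure R]_(u in `[s, t]) 'D_v f (x + u *: v).

(* Weak differentiability in its ACL form: absolute continuity on almost every
   line parallel to a coordinate axis.  Local integrability of the derivatives
   is not included. *)
Definition weakly_differentiable (d : measure_display) (T : measurableType d)
    (R : realType) (P : probability T R) (n p : nat)
    (X : 'I_n -> 'I_p -> {RV P >-> R})
    (g : 'M[R]_(n, p) -> 'M[R]_(n, p)) : Prop :=
  forall (a b : 'I_n) (i j : 'I_p),
    law_ae X (line_abs_continuous (fun x => g x b j) (delta_mx a i)).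

(* Main.v *)
(** Write [g] for the gradient of [h] and [Z = X - M].  Expanding the loss
    entrywise and applying Stein's identity to each entry of [X] separately (by
    independence an entry may be resampled without changing the law of [X])
    turns [E Z_ai g_aj] into [E d_ai g_aj], so that the risk is [n I_p] plus the
    expectation of [G + G^T + g^T g], where [G_ij = sum_a d_ai g_aj].  This
    matrix is equivariant under [x |-> P x Q], so by the singular value
    decomposition it need only be computed at a rectangular diagonal matrix.
    There, reflections kill the off-diagonal entries, the gradient and the
    second derivatives in the diagonal directions come from curves moving a
    single eigenvalue, and the remaining second derivatives are obtained by
    differentiating the equivariance of [g] along rotations.  The eigenvalues
    [lambda_k], [k <= min n p], are almost surely distinct and nonzero, because a nonzero
    polynomial in the entries of [X] vanishes where they are not. *)

From HB Require Import structures.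
Require Import Defs.
From mathcomp Require Import all_boot all_order all_algebra.
From mathcomp Require Import all_classical all_reals all_analysis.
From mathcomp Require Import measurable_realfun.
From mathcomp Require Import ring lra.
Import Order.TTheory GRing.Theory Num.Theory.
Import numFieldNormedType.Exports.
Set Implicit Arguments.
Unset Strict Implicit.
Unset Printing Implicit Defensive.
Local Open Scope classical_set_scope.
Local Open Scope ring_scope.

(** * Equivariance of the gradient *)

(** Smoothness is assumed for [h] alone, and only almost everywhere; [H] and [lam] carry no such
    hypothesis. Every derivative of [H] is therefore extracted from [h] along a curve on which the
    whole spectrum is known exactly. On the probabilistic side the obstacle is that the gradient is
    controlled only off a null set. Measurable versions are obtained by cutting functions off null
    sets, the final integrals are compared almost everywhere, and null sets of matrices are traced
    on coordinate lines through resampling, so that no density on the space of matrices has to be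
    constructed. On a line, Stein's identity comes from Fubini's theorem applied to a kernel rather
    than from integration by parts, since nothing is known about the gradient at infinity. *)

Section mx_calculus.
Context {R : realType}.

Lemma is_diff_mulmxlr (m n p q : nat) (A : 'M[R]_(m, n)) (B : 'M[R]_(p, q))
    (z : 'M[R]_(n, p)) :
  differentiable (fun y : 'M[R]_(n, p) => A *m y *m B : 'M[R]_(m, q)) z /\
  forall v : 'M[R]_(n, p),
    'd (fun y : 'M[R]_(n, p) => A *m y *m B : 'M[R]_(m, q)) z v = A *m v *m B.
Proof.
pose f (y : 'M[R]_(n, p)) : 'M[R]_(m, q) := A *m y *m B.
have lf : linear f.
  by move=> k u v; rewrite /f mulmxDr mulmxDl -scalemxAr -scalemxAl.
pose fL := HB.pack f (GRing.isLinear.Build _ _ _ _ _ lf) :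
  {linear 'M[R]_(n, p) -> 'M[R]_(m, q)}.
have df y : differentiable f y.
  (* A linear map is a finite sum of coordinates times fixed matrices; this supplies the continuity
     that [diff_lin] asks for. *)
  have -> : f = (\sum_(i < n) fun y : 'M[R]_(n, p) =>
      (\sum_(j < p) fun y : 'M[R]_(n, p) => y i j *: f (delta_mx i j)) y).
    apply/funext => x; rewrite fct_sumE -[LHS]/(fL x) {1}[x]matrix_sum_delta.
    rewrite linear_sum; apply: eq_bigr => i _; rewrite linear_sum fct_sumE.
    by apply: eq_bigr => j _; rewrite linearZ.
  apply: differentiable_sum => i; apply: differentiable_sum => j.
  apply: differentiableZl; exact: differentiable_coord.
split; first exact: df.
have -> : (fun y : 'M[R]_(n, p) => A *m y *m B : 'M[R]_(m, q)) = fL by [].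
move=> v; rewrite diff_lin // => y.
exact/differentiable_continuous/df.
Qed.

Lemma derive_sum_delta (n p : nat) (W : normedModType R) (f : 'M[R]_(n, p) -> W)
    (y v : 'M[R]_(n, p)) : differentiable f y ->
  'D_v f y = \sum_(a < n) \sum_(i < p) v a i *: 'D_(delta_mx a i) f y.
Proof.
move=> df; rewrite deriveE // {1}[v]matrix_sum_delta linear_sum.
apply: eq_bigr => a _; rewrite linear_sum; apply: eq_bigr => i _.
by rewrite linearZ deriveE.
Qed.

Lemma derive_comp_curve (n p : nat) (W : normedModType R) (f : 'M[R]_(n, p) -> W)
    (c : R -> 'M[R]_(n, p)) (t : R) (v : 'M[R]_(n, p)) :
  differentiable f (c t) -> is_derive t 1 c v ->
  is_derive t (1 : R) (f \o c) ('D_v f (c t)).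
Proof.
move=> df [dc cv].
have {}dc : differentiable c t by apply/derivable1_diffP.
apply: DeriveDef.
  apply/derivable1_diffP; exact: differentiable_comp.
rewrite deriveE; last exact: differentiable_comp.
by rewrite diff_comp //= -(deriveE (1 : R^o) dc) cv deriveE.
Qed.

Lemma derive_entry (n p m q : nat) (f : 'M[R]_(n, p) -> 'M[R]_(m, q))
    (y v : 'M[R]_(n, p)) (a : 'I_m) (j : 'I_q) : differentiable f y ->
  'D_v (fun x => f x a j) y = ('D_v f y) a j.
Proof.
by move=> df; rewrite derive_mx ?mxE //; exact: diff_derivable.
Qed.

(** The little-o expansion depends only on the germ at [x]. This locality is needed because the
    gradient is equivariant only where [h] is differentiable, hence only near the point
    considered. *)
Lemma near_eq_differentiable (V W : normedModType R) (f g : V -> W) (x : V) :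
  {near x, f =1 g} -> differentiable f x -> differentiable g x.
Proof.
move=> fg /diff_locallyP[cf fE].
have gE : g \o shift x = cst (g x) + 'd f x +o_ 0 id.
  apply/eqaddoP => e e0; move/eqaddoP : fE => /(_ e e0).
  have : \forall y \near 0, f (y + x) = g (y + x).
    move: fg; rewrite (near_shift 0) subr0; apply: filterS => y /=.
    by [].
  apply: filterS2 => y /= fgy; rewrite -(nbhs_singleton fg).
  by rewrite !fctE /= fgy.
apply/diff_locallyP; rewrite (diff_unique cf gE); split => //.
Qed.

Lemma mul_delta_mxlr (m n p q : nat) (A : 'M[R]_(m, n)) (B : 'M[R]_(p, q)) a i b k :
  (A *m delta_mx a i *m B) b k = A b a * B i k.
Proof.
rewrite mxE (bigD1 i) //= big1 ?addr0; last first.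
  move=> j ji; rewrite !mxE big1 ?mul0r // => c _.
  by rewrite !mxE (negPf ji) andbF mulr0.
rewrite !mxE (bigD1 a) //= big1 ?addr0; last first.
  by move=> j ja; rewrite !mxE (negPf ja) mulr0.
by rewrite !mxE !eqxx mulr1.
Qed.

End mx_calculus.

Section invariance.
Context {R : realType} {n p : nat}.
Variable h : 'M[R]_(n, p) -> R.
Hypothesis h_inv : orthogonally_invariant h.

Lemma orthogonal_mx_tr (m : nat) (Q : 'M[R]_m) :
  orthogonal_mx Q -> orthogonal_mx Q^T.
Proof. by move=> QQ; rewrite /orthogonal_mx trmxK; apply: mulmx1C. Qed.

Lemma orthogonal_mxK (m : nat) (Q : 'M[R]_m) :
  orthogonal_mx Q -> Q *m Q^T = 1%:M.
Proof. by move=> QQ; apply: mulmx1C. Qed.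

Lemma orthogonal_mx1 (m : nat) : orthogonal_mx (1%:M : 'M[R]_m).
Proof. by rewrite /orthogonal_mx trmx1 mulmx1. Qed.

Lemma orthlrK (P : 'M[R]_n) (Q : 'M[R]_p) (y : 'M[R]_(n, p)) :
  orthogonal_mx P -> orthogonal_mx Q -> P^T *m (P *m y *m Q) *m Q^T = y.
Proof.
move=> oP oQ; rewrite !mulmxA oP mul1mx -mulmxA orthogonal_mxK //.
by rewrite mulmx1.
Qed.

Lemma orthlrVK (P : 'M[R]_n) (Q : 'M[R]_p) (y : 'M[R]_(n, p)) :
  orthogonal_mx P -> orthogonal_mx Q -> P *m (P^T *m y *m Q^T) *m Q = y.
Proof.
move=> /orthogonal_mx_tr oP /orthogonal_mx_tr oQ.
by have := orthlrK y oP oQ; rewrite !trmxK.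
Qed.

Lemma orthinv_differentiable (P : 'M[R]_n) (Q : 'M[R]_p) (y : 'M[R]_(n, p)) :
  orthogonal_mx P -> orthogonal_mx Q -> differentiable h y ->
  differentiable h (P *m y *m Q).
Proof.
move=> oP oQ dh.
have -> : h = h \o (fun z => P^T *m z *m Q^T).
  by apply/funext => z /=; rewrite h_inv //; exact: orthogonal_mx_tr.
apply: differentiable_comp; first exact: (is_diff_mulmxlr _ _ _).1.
by rewrite orthlrK.
Qed.

(** The two difference quotients are the same function of the increment, by linearity of
    [u |-> P u Q]. *)
Lemma derive_orth (W : normedModType R) (f : 'M[R]_(n, p) -> W)
    (P : 'M[R]_n) (Q : 'M[R]_p) (y z : 'M[R]_(n, p)) :
  'D_(P *m z *m Q) f (P *m y *m Q) = 'D_z (fun u => f (P *m u *m Q)) y.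
Proof.
rewrite /derive; set d1 := (fun _ : R => _); set d2 := (fun _ : R => _).
suff -> : d1 = d2 by [].
apply/funext => t; rewrite /d1 /d2 /=.
by rewrite mulmxDr mulmxDl -scalemxAr -scalemxAl.
Qed.

Lemma mgrad_orth (P : 'M[R]_n) (Q : 'M[R]_p) (y : 'M[R]_(n, p)) :
  orthogonal_mx P -> orthogonal_mx Q -> differentiable h y ->
  mgrad h (P *m y *m Q) = P *m mgrad h y *m Q.
Proof.
move=> oP oQ dh; apply/matrixP => a i; rewrite mxE.
(* The direction is pulled back to [P^T *m delta_mx a i *m Q^T] at [y]; its coordinates are products
   of an entry of [P] and an entry of [Q], which rebuild the matrix product. *)
rewrite -(orthlrVK (delta_mx a i) oP oQ) derive_orth.
have -> : (fun u => h (P *m u *m Q)) = h.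
  by apply/funext => u; rewrite h_inv.
rewrite derive_sum_delta // !mxE exchange_big /=; apply: eq_bigr => k _.
rewrite !mxE big_distrl; apply: eq_bigr => b _ /=.
by rewrite mul_delta_mxlr !mxE mulrAC.
Qed.

Lemma twice_differentiable_orth (P : 'M[R]_n) (Q : 'M[R]_p) (y z : 'M[R]_(n, p)) :
  orthogonal_mx P -> orthogonal_mx Q -> twice_differentiable h y ->
  twice_differentiable h (P *m y *m Q) /\
  'D_(P *m z *m Q) (mgrad h) (P *m y *m Q) = P *m 'D_z (mgrad h) y *m Q.
Proof.
move=> oP oQ [hd gd].
have mgE : {near y, (fun u => mgrad h (P *m u *m Q)) =1
    (fun u => P *m mgrad h u *m Q)}.
  by near=> u; apply: mgrad_orth => //; near: u.
have cV u : (fun x : 'M[R]_(n, p) => P^T *m x *m Q^T) x @[x --> u] -->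
    P^T *m u *m Q^T.
  apply: (@differentiable_continuous _ _ _ u (fun x => P^T *m x *m Q^T)).
  exact: (is_diff_mulmxlr P^T Q^T u).1.
(* Near the image point the gradient is thus a composite of linear maps with the gradient near [y],
   which makes it differentiable there. *)
have gE : {near P *m y *m Q, (fun u => P *m mgrad h (P^T *m u *m Q^T) *m Q) =1
    mgrad h}.
  have : \forall u \near P *m y *m Q,
      mgrad h (P *m (P^T *m u *m Q^T) *m Q) = P *m mgrad h (P^T *m u *m Q^T) *m Q.
    by move: (cV (P *m y *m Q)); rewrite orthlrK // => cc; exact: (cc _ mgE).
  by move=> H0; near=> u; rewrite /= -[in RHS](orthlrVK u oP oQ); apply/esym; near: u.
have dPgQ (u : 'M[R]_(n, p)) : differentiable (mgrad h) u ->
    differentiable (fun u => P *m mgrad h u *m Q) u.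
  move=> du; apply: (differentiable_comp (g := fun x => P *m x *m Q)) => //.
  exact: (is_diff_mulmxlr _ _ _).1.
have dcomp : differentiable (fun u => P *m mgrad h (P^T *m u *m Q^T) *m Q)
    (P *m y *m Q).
  apply: (differentiable_comp (f := fun x => P^T *m x *m Q^T)
    (g := fun u => P *m mgrad h u *m Q)).
    exact: (is_diff_mulmxlr _ _ _).1.
  by rewrite orthlrK //; exact: dPgQ.
split.
  split.
    have : \forall u \near P *m y *m Q, differentiable h (P^T *m u *m Q^T).
      by move: (cV (P *m y *m Q)); rewrite orthlrK // => cc; exact: (cc _ hd).
    apply: filterS => u /= du.
    by rewrite -(orthlrVK u oP oQ); exact: orthinv_differentiable.
  exact: near_eq_differentiable gE dcomp.
rewrite derive_orth (near_eq_derive _ mgE) deriveE; last exact: dPgQ.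
rewrite (_ : (fun u => _) = (fun x => P *m x *m Q) \o mgrad h) //.
rewrite diff_comp //; last exact: (is_diff_mulmxlr _ _ _).1.
by rewrite /= (is_diff_mulmxlr _ _ _).2 deriveE.
Unshelve. all: by end_near. Qed.

End invariance.

(** * Plane rotations and their generators *)

Section rotation.
Context {R : realType}.

Definition skew_mx (m : nat) (a b : 'I_m) : 'M[R]_m := delta_mx a b - delta_mx b a.

(** The exponential of [t *: skew_mx a b] when [a != b]. Written as an affine expression in [cos t]
    and [sin t], it can be differentiated without a matrix exponential. *)
Definition rot_mx (m : nat) (a b : 'I_m) (t : R) : 'M[R]_m :=
  1%:M + (cos t - 1) *: (delta_mx a a + delta_mx b b) + sin t *: skew_mx a b.

Lemma rot_mx0 (m : nat) (a b : 'I_m) : rot_mx a b 0 = 1%:M.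
Proof. by rewrite /rot_mx cos0 sin0 subrr !scale0r !addr0. Qed.

Lemma rot_mx_orthogonal (m : nat) (a b : 'I_m) (t : R) :
  a != b -> orthogonal_mx (rot_mx a b t).
Proof.
move=> ab; rewrite /orthogonal_mx /rot_mx /skew_mx.
(* [C] is the projection on the plane of [a] and [b], and [J] a quarter turn of it; the relations
   between them reduce orthogonality to [cos ^ 2 + sin ^ 2 = 1]. *)
set C := delta_mx a a + _; set J := delta_mx a b - _.
have CT : C^T = C by rewrite /C linearD /= !trmx_delta.
have JT : J^T = - J by rewrite /J linearB /= !trmx_delta opprB.
have ba : (b == a) = false by rewrite eq_sym (negPf ab).
have CC : C *m C = C.
  rewrite /C mulmxDl !mulmxDr !mul_delta_mx_cond !eqxx !mulr1n.
  by rewrite (negPf ab) ba !mulr0n addr0 add0r.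
have CJ : C *m J = J.
  rewrite /C /J mulmxDl !mulmxBr !mul_delta_mx_cond !eqxx !mulr1n.
  by rewrite (negPf ab) ba !mulr0n subr0 sub0r.
have JC : J *m C = J.
  rewrite /C /J mulmxBl !mulmxDr !mul_delta_mx_cond !eqxx !mulr1n.
  by rewrite (negPf ab) ba !mulr0n addr0 add0r.
have JJ : J *m J = - C.
  rewrite /C /J mulmxBl !mulmxBr !mul_delta_mx_cond !eqxx !mulr1n.
  by rewrite (negPf ab) ba !mulr0n subr0 sub0r opprD addrC.
move: CT JT CC CJ JC JJ; move: C J => C J CT JT CC CJ JC JJ.
rewrite !linearD /= !linearZ /= trmx1 CT JT.
rewrite !(mulmxDl, mulmxDr) !mulmx1 !mul1mx -!scalemxAl ?mulNmx.
rewrite CC CJ JC JJ; apply/matrixP => i j; rewrite !mxE.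
transitivity ((i == j)%:R + (cos t ^+ 2 + sin t ^+ 2 - 1) * C i j); first by ring.
by rewrite cos2Dsin2 subrr mul0r addr0.
Qed.

Lemma is_derive_rot_curve (n p : nat) (y C J : 'M[R]_(n, p)) :
  is_derive (0 : R) (1 : R)
    (fun t : R => y + (cos t - 1) *: C + sin t *: J) J.
Proof.
have H i j : is_derive (0 : R) (1 : R)
    (fun t : R => (y + (cos t - 1) *: C + sin t *: J) i j) (J i j).
  rewrite (_ : (fun t => _) = (fun t => y i j + (cos t - 1) * C i j + sin t * J i j)).
    apply: is_derive_eq; rewrite /= cos0 sin0 /GRing.scale /=; ring.
  by apply/funext => t; rewrite !mxE.
have dc : derivable (fun t : R => y + (cos t - 1) *: C + sin t *: J) 0 1.
  by apply/derivable_mxP => i j; case: (H i j).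
apply: DeriveDef => //.
by rewrite derive_mx //; apply/matrixP => i j; rewrite mxE; case: (H i j).
Qed.

End rotation.

Section invariance_rotation.
Context {R : realType} {n p : nat}.
Variable h : 'M[R]_(n, p) -> R.
Hypothesis h_inv : orthogonally_invariant h.

(** Both sides of [mgrad h (rot_mx a b t *m y) = rot_mx a b t *m mgrad h y] are differentiated at
    [t = 0]: the left by the chain rule, the right as an explicit curve, in which the cosine part
    has zero derivative. *)
Lemma derive_skewl (y : 'M[R]_(n, p)) (a b : 'I_n) : a != b ->
  twice_differentiable h y ->
  'D_(skew_mx a b *m y) (mgrad h) y = skew_mx a b *m mgrad h y.
Proof.
move=> ab [hd gd]; pose c t : 'M[R]_(n, p) := rot_mx a b t *m y.
have rotE (z : 'M[R]_(n, p)) : (fun t => rot_mx a b t *m z) =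
    (fun t : R => z + (cos t - 1) *: ((delta_mx a a + delta_mx b b) *m z)
      + sin t *: (skew_mx a b *m z)).
  by apply/funext => t; rewrite /rot_mx 2!mulmxDl mul1mx -!scalemxAl.
have c0 : c 0 = y by rewrite /c rot_mx0 mul1mx.
have dc : is_derive (0 : R) (1 : R) c (skew_mx a b *m y).
  by rewrite /c rotE; exact: is_derive_rot_curve.
have gd0 : differentiable (mgrad h) (c 0) by rewrite c0.
have := derive_comp_curve gd0 dc.
have -> : mgrad h \o c = fun t => rot_mx a b t *m mgrad h y.
  apply/funext => t /=; rewrite /c -[in LHS](mulmx1 (_ *m y)).
  rewrite mgrad_orth ?mulmx1 //; first exact: rot_mx_orthogonal.
    exact: orthogonal_mx1.
  exact: nbhs_singleton hd.
rewrite rotE c0 => - [_ <-].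
by have [_ ->] := is_derive_rot_curve (mgrad h y)
  ((delta_mx a a + delta_mx b b) *m mgrad h y) (skew_mx a b *m mgrad h y).
Qed.

Lemma derive_skewr (y : 'M[R]_(n, p)) (a b : 'I_p) : a != b ->
  twice_differentiable h y ->
  'D_(y *m skew_mx a b) (mgrad h) y = mgrad h y *m skew_mx a b.
Proof.
move=> ab [hd gd]; pose c t : 'M[R]_(n, p) := y *m rot_mx a b t.
have rotE (z : 'M[R]_(n, p)) : (fun t => z *m rot_mx a b t) =
    (fun t : R => z + (cos t - 1) *: (z *m (delta_mx a a + delta_mx b b))
      + sin t *: (z *m skew_mx a b)).
  by apply/funext => t; rewrite /rot_mx 2!mulmxDr mulmx1 -!scalemxAr.
have c0 : c 0 = y by rewrite /c rot_mx0 mulmx1.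
have dc : is_derive (0 : R) (1 : R) c (y *m skew_mx a b).
  by rewrite /c rotE; exact: is_derive_rot_curve.
have gd0 : differentiable (mgrad h) (c 0) by rewrite c0.
have := derive_comp_curve gd0 dc.
have -> : mgrad h \o c = fun t => mgrad h y *m rot_mx a b t.
  apply/funext => t /=; rewrite /c -[in LHS](mul1mx y).
  rewrite mgrad_orth ?mul1mx //; first exact: orthogonal_mx1.
    exact: rot_mx_orthogonal.
  exact: nbhs_singleton hd.
rewrite rotE c0 => - [_ <-].
by have [_ ->] := is_derive_rot_curve (mgrad h y)
  (mgrad h y *m (delta_mx a a + delta_mx b b)) (mgrad h y *m skew_mx a b).
Qed.

End invariance_rotation.

(** * Derivatives at a rectangular diagonal matrix *)

Section singular_point.
Context {R : realType}.

(** The diagonal is a sequence on [nat], so that [s] can be read at row and column indices alike,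
    whichever of [n] and [p] is larger. *)
Definition sing_mx (n p : nat) (s : nat -> R) : 'M[R]_(n, p) :=
  \matrix_(a, i) (s a *+ (a == i :> nat)).

(* The reflections [flip_mx _ k] on both sides fix every [sing_mx n p s], hence
   the entries of the gradient and of the Hessian that are odd in the index [k]
   vanish there. *)
Definition flip_mx (m k : nat) : 'M[R]_m := diag_mx (\row_i (-1) ^+ (i == k :> nat)).

Lemma flip_mxlr (n p k : nat) (z : 'M[R]_(n, p)) a i :
  (flip_mx n k *m z *m flip_mx p k) a i =
  (-1) ^+ (a == k :> nat) * (-1) ^+ (i == k :> nat) * z a i.
Proof. by rewrite mul_mx_diag mxE mul_diag_mx !mxE mulrAC. Qed.

Lemma flip_mx_orthogonal (m k : nat) : orthogonal_mx (flip_mx m k).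
Proof.
rewrite /orthogonal_mx /flip_mx tr_diag_mx mul_diag_mx; apply/matrixP => i j.
rewrite !mxE mulrnAr -expr2 -exprM mulnC exprM sqrrN expr1n expr1n.
by [].
Qed.

Lemma flip_sing_mx (n p k : nat) (s : nat -> R) :
  flip_mx n k *m sing_mx n p s *m flip_mx p k = sing_mx n p s.
Proof.
apply/matrixP => a i; rewrite flip_mxlr !mxE.
have [->|_] := eqVneq (a : nat) i; last by rewrite !mulr0n mulr0.
by rewrite -expr2 -exprM mulnC exprM sqrrN expr1n expr1n mul1r.
Qed.

Variables (n p : nat) (h : 'M[R]_(n, p) -> R).
Hypothesis h_inv : orthogonally_invariant h.
Variable s : nat -> R.
Let y := sing_mx n p s.
Hypothesis dy : twice_differentiable h y.

Lemma mgrad_sing_offdiag (a : 'I_n) (i : 'I_p) : (a != i :> nat) -> mgrad h y a i = 0.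
Proof.
move=> ai; have [hd gd] := dy.
have := mgrad_orth h_inv (@flip_mx_orthogonal n a) (@flip_mx_orthogonal p a)
  (nbhs_singleton hd).
rewrite flip_sing_mx => /matrixP /(_ a i).
rewrite flip_mxlr eqxx eq_sym (negPf ai) expr1 expr0 mulr1 mulN1r => E.
by lra.
Qed.

(** Flip the index [i]. The direction [delta_mx a i] gets one sign from its column and possibly
    another from its row; the entry [(a, j)] gets only the latter. The derivative is therefore its
    own opposite. *)
Lemma hess_sing_offdiag (a : 'I_n) (i j : 'I_p) : i != j ->
  ('D_(delta_mx a i) (mgrad h) y) a j = 0.
Proof.
move=> ij.
have [_] := twice_differentiable_orth h_inv (delta_mx a i)
  (@flip_mx_orthogonal n i) (@flip_mx_orthogonal p i) dy.
rewrite flip_sing_mx => /matrixP /(_ a j).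
have -> : flip_mx n i *m delta_mx a i *m flip_mx p i =
    ((-1) ^+ (a == i :> nat) * (-1)) *: delta_mx a i.
  apply/matrixP => b k; rewrite flip_mxlr !mxE.
  have [->|_] := eqVneq b a; last by rewrite !mulr0.
  have [->|_] := eqVneq k i; last by rewrite !mulr0.
  by rewrite eqxx.
have gd := dy.2.
rewrite deriveE // linearZ -deriveE // flip_mxlr !mxE.
rewrite -(inj_eq val_inj) /= in ij; rewrite [(j : nat) == i]eq_sym (negPf ij) mulr1.
by case: eqP => _; rewrite ?expr1 ?expr0 => E; lra.
Qed.

Let g := mgrad h y.

(* Zero when an index is out of range, as happens for the transposed position of
   an entry outside the leading square block. *)
Definition ndelta_mx (b k : nat) : 'M[R]_(n, p) :=
  \matrix_(c, l) ((c == b :> nat) && (l == k :> nat))%:R.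

(* Rotating the rows [a], [i], resp. the columns [a], [i], gives two linear
   equations for the derivatives of [g a i] in the directions [(a, i)] and
   [(i, a)]. *)
Lemma hess_sing_skewl (a i' : 'I_n) (i : 'I_p) :
  i = i' :> nat -> a != i' ->
  s i * ('D_(delta_mx a i) (mgrad h) y) a i -
  s a * ('D_(ndelta_mx i a) (mgrad h) y) a i = g i' i.
Proof.
move=> ii ai.
have := derive_skewl h_inv ai dy.
have -> : skew_mx a i' *m y = s i *: delta_mx a i - s a *: ndelta_mx i a.
  rewrite /skew_mx mulmxBl; apply/matrixP => b k; rewrite !mxE.
  rewrite (bigD1 i') //= big1 ?addr0; last first.
    by move=> c ca; rewrite !mxE (negPf ca) andbF mul0r.
  rewrite (bigD1 a) //= big1 ?addr0; last first.
    by move=> c ca; rewrite !mxE (negPf ca) andbF mul0r.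
  rewrite !mxE !eqxx !andbT -!(inj_eq val_inj) /= -ii.
  rewrite [(i : nat) == k]eq_sym [(a : nat) == k]eq_sym.
  by case: (b == a :> nat); case: (b == i :> nat); case: (k == i :> nat);
    case: (k == a :> nat);
    rewrite /= ?mulr0n ?mulr1n ?mulr0 ?mul0r ?mulr1 ?mul1r.
have gd := dy.2.
rewrite deriveE // linearB !linearZ -!deriveE // => /matrixP/(_ a i).
rewrite /skew_mx mulmxBl !mxE => ->.
rewrite (bigD1 i') //= big1 ?addr0; last first.
  by move=> c ca; rewrite !mxE (negPf ca) andbF mul0r.
rewrite big1 ?subr0; first by rewrite !mxE !eqxx mul1r.
by move=> c _; rewrite !mxE (negPf ai) mul0r.
Qed.

Lemma hess_sing_skewr (a : 'I_n) (a' i : 'I_p) :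
  a = a' :> nat -> a' != i ->
  s a * ('D_(delta_mx a i) (mgrad h) y) a i -
  s i * ('D_(ndelta_mx i a) (mgrad h) y) a i = g a a'.
Proof.
move=> aa ai.
have := derive_skewr h_inv ai dy.
have -> : y *m skew_mx a' i = s a *: delta_mx a i - s i *: ndelta_mx i a.
  rewrite /skew_mx mulmxBr; apply/matrixP => b k; rewrite !mxE.
  rewrite (bigD1 a') //= big1 ?addr0; last first.
    by move=> c ca; rewrite !mxE (negPf ca) mulr0.
  rewrite (bigD1 i) //= big1 ?addr0; last first.
    by move=> c ca; rewrite !mxE (negPf ca) mulr0.
  rewrite !mxE !eqxx -!(inj_eq val_inj) /= -aa.
  have -> : s b *+ (b == a :> nat) = s a *+ (b == a :> nat) by case: eqP => [->|].
  have -> : s b *+ (b == i :> nat) = s i *+ (b == i :> nat) by case: eqP => [->|].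
  by case: (b == a :> nat); case: (b == i :> nat); case: (k == i :> nat);
    case: (k == a :> nat);
    rewrite /= ?mulr0n ?mulr1n ?mulr0 ?mul0r ?mulr1 ?mul1r.
have gd := dy.2.
rewrite deriveE // linearB !linearZ -!deriveE // => /matrixP/(_ a i).
rewrite /skew_mx mulmxBr !mxE => ->.
rewrite (bigD1 a') //= big1 ?addr0; last first.
  by move=> c ca; rewrite !mxE (negPf ca) mulr0.
rewrite big1 ?subr0; first by rewrite !mxE !eqxx mulr1.
by move=> c _; rewrite !mxE [i == a']eq_sym (negPf ai) andbF mulr0.
Qed.

End singular_point.

(** * Uniqueness of the ordered spectrum *)

Section spectrum.
Context {R : realType}.

Lemma char_poly_orth_conj (p : nat) (V A : 'M[R]_p) :
  orthogonal_mx V -> char_poly (V *m A *m V^T) = char_poly A.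
Proof.
move=> /orthogonal_mxK VV; rewrite /char_poly.
have VV' : map_mx polyC V *m map_mx polyC V^T = 1%:M.
  by rewrite -map_mxM VV map_mx1.
have -> : char_poly_mx (V *m A *m V^T) =
    map_mx polyC V *m char_poly_mx A *m map_mx polyC V^T.
  rewrite /char_poly_mx !map_mxM mulmxBr mulmxBl; congr (_ - _).
  by rewrite mul_mx_scalar -scalemxAl VV' scalemx1.
by rewrite !det_mulmx mulrAC -det_mulmx VV' det1 mul1r.
Qed.

(** The eigenvalues are the roots of the characteristic polynomial with multiplicity, and a multiset
    has only one sorted listing. This evaluates the given [lam] wherever some decomposition can be
    written down. *)
Lemma spectral_decomposition_uniq (p : nat) (S V V' : 'M[R]_p) (l l' : 'rV[R]_p) :
  spectral_decomposition S V l -> spectral_decomposition S V' l' -> l = l'.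
Proof.
have key (U : 'M[R]_p) (k : 'rV[R]_p) : spectral_decomposition S U k ->
    char_poly S = \prod_(x <- [tuple k 0 i | i < p]) ('X - x%:P) /\
    sorted >=%O [tuple k 0 i | i < p].
  move=> [oU SE sk]; split.
    rewrite SE char_poly_orth_conj // char_poly_trig ?diag_mx_is_trig //.
    rewrite big_tuple; apply: eq_bigr => i _.
    by rewrite tnth_mktuple mxE eqxx mulr1n.
  apply/(sortedP 0) => i; rewrite size_tuple => ip.
  have ip' : (i < p)%N by exact: ltn_trans ip.
  have := sk (Ordinal ip') (Ordinal ip) (leqnSn i).
  by rewrite -[X in X <= _]tnth_mktuple -[X in _ <= X]tnth_mktuple !(tnth_nth 0).
move=> /key[cE sl] /key[cE' sl'].
have /prod_XsubC_eq pe := etrans (esym cE) cE'.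
have ge_anti : antisymmetric (>=%O : rel R).
  by move=> x y; rewrite andbC; exact: le_anti.
have ge_tr : transitive (>=%O : rel R).
  by move=> x y z /= yx zx; exact: le_trans zx yx.
have E := sorted_eq ge_tr ge_anti sl sl' pe.
apply/rowP => i; have := congr1 (fun t => nth 0 t i) E.
by rewrite -!tnth_nth !tnth_mktuple.
Qed.

Lemma sing_mx_gram (n p : nat) (s : nat -> R) :
  (forall k, (n <= k)%N -> s k = 0) ->
  (sing_mx n p s)^T *m sing_mx n p s = diag_mx (\row_k s k ^+ 2).
Proof.
move=> s0; apply/matrixP => i j; rewrite !mxE.
(* A column of index at least [n] contains no diagonal position, so its norm is 0; the hypothesis on
   [s] makes the right-hand side agree. *)
have [ni|ni] := leqP n i.
  rewrite s0 // expr0n /= mul0rn big1 // => a _; rewrite !mxE.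
  case: eqP => [ai|]; last by rewrite mulr0n mul0r.
  by have := ltn_ord a; rewrite ai ltnNge ni.
rewrite (bigD1 (Ordinal ni)) //= big1 ?addr0; last first.
  move=> a; rewrite !mxE -(inj_eq val_inj) /= => /negPf ->.
  by rewrite mulr0n mul0r.
by rewrite !mxE /= eqxx mulr1n mulrnAr expr2.
Qed.

(** The difference quotients coincide, so the equality does not depend on the limit existing. It
    turns the first and second [pderiv] of [H] into derivatives in one real variable. *)
Lemma derive_line (V W : normedModType R) (f : V -> W) (x v : V) (t : R) :
  'D_v f (t *: v + x) = 'D_1 (fun u : R => f (u *: v + x)) t.
Proof.
rewrite /derive; apply: (congr1 (fun F : R -> W => lim (F @ 0^'))).
apply/funext => u /=.
by rewrite addrA -scalerDl [u *: 1]mulr1.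
Qed.

End spectrum.

(** * Derivatives obtained by moving one eigenvalue *)

Section eigenvalue_derivatives.
Context {R : realType} {n p : nat}.
Variables (h : 'M[R]_(n, p) -> R) (H : 'rV[R]_p -> R).
Variables (lam : 'M[R]_(n, p) -> 'rV[R]_p) (V : 'M[R]_(n, p) -> 'M[R]_p).
Hypothesis spectral : forall x : 'M[R]_(n, p),
  spectral_decomposition (x^T *m x) (V x) (lam x).
Hypothesis h_eq : forall x, h x = H (lam x).
Variable s : nat -> R.
Hypothesis s0 : forall k, (minn n p <= k)%N -> s k = 0.
Hypothesis s_gt0 : forall k, (k < minn n p)%N -> 0 < s k.
Hypothesis s_decr : forall i j, (i < j)%N -> (j < minn n p)%N -> s j < s i.
Hypothesis dy : twice_differentiable h (sing_mx n p s).

Let l : 'rV[R]_p := \row_k s k ^+ 2.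

Variables (kn : 'I_n) (k : 'I_p).
Hypothesis knk : kn = k :> nat.

Let kmin : (k < minn n p)%N.
Proof. by rewrite leq_min ltn_ord -knk ltn_ord. Qed.

Let sk0 : 0 < s k. Proof. exact: s_gt0. Qed.

(* Along this curve the [k]-th eigenvalue moves at unit speed and the others
   stay put. *)
Let c (r : R) : 'M[R]_(n, p) :=
  sing_mx n p s + (Num.sqrt (s k ^+ 2 + r) - s k) *: delta_mx kn k.

Let c0 : c 0 = sing_mx n p s.
Proof. by rewrite /c addr0 sqrtr_sqr gtr0_norm // subrr scale0r addr0. Qed.

(** The Gram matrix of [c r] is diagonal with the displayed entries; for small [r] they are still in
    nonincreasing order, so uniqueness of the ordered spectrum identifies them with [lam (c r)]. *)
Lemma lam_sing_near :
  \forall r \near 0, lam (c r) = r *: delta_mx 0 k + l.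
Proof.
have sle i j : (i < j)%N -> s j ^+ 2 <= s i ^+ 2.
  move=> ij; have [mj|jm] := leqP (minn n p) j.
    by rewrite (s0 mj) expr0n /= sqr_ge0.
  rewrite lerXn2r ?nnegrE ?ltW // ?s_gt0 ?s_decr //; exact: ltn_trans jm.
have slt i j : (i < j)%N -> (i < minn n p)%N -> s j ^+ 2 < s i ^+ 2.
  move=> ij im; have [mj|jm] := leqP (minn n p) j.
    by rewrite (s0 mj) expr0n /= exprn_gt0 // s_gt0.
  by rewrite ltrXn2r ?nnegrE ?ltW // ?s_gt0 ?s_decr.
(* Only pairs containing [k] are affected, and since [k < minn n p] their gap at [r = 0] is strict,
   also against the zero eigenvalues. There are finitely many pairs, so one neighbourhood serves
   all. *)
have Hsort : \forall r \near (0 : R), forall i j : 'I_p, (i < j)%N ->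
    s j ^+ 2 + r * (j == k)%:R <= s i ^+ 2 + r * (i == k)%:R.
  pose Q (i j : 'I_p) (r : R) := (i < j)%N ->
    s j ^+ 2 + r * (j == k)%:R <= s i ^+ 2 + r * (i == k)%:R.
  suff HQ i j : \forall r \near (0 : R), Q i j r.
    have HQ' i : \forall r \near (0 : R), forall j, Q i j r.
      exact: (@filter_forall R _ (fun j r => Q i j r) (nbhs (0 : R)) _ (HQ i)).
    exact: (@filter_forall R _ (fun i r => forall j, Q i j r) (nbhs (0 : R)) _ HQ').
  rewrite /Q.
  have [ij|ij] := ltnP i j; last by near=> r.
  have [ik|ik] := eqVneq i k.
    have jk : (j == k) = false by rewrite -ik; apply/negbTE; rewrite neq_ltn ij orbT.
    have lt0 : s j ^+ 2 - s i ^+ 2 < 0 by rewrite subr_lt0 slt // ik.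
    near=> r; move=> _; rewrite jk /= mulr0n mulr0 mulr1n mulr1 addr0 -lerBlDl ltW //.
    by near: r; exact: lt_nbhsr.
  have [jk|jk] := eqVneq j k; last first.
    by near=> r => _; rewrite /= mulr0n mulr0 !addr0; exact: sle.
  have lt0 : 0 < s i ^+ 2 - s j ^+ 2.
    by rewrite subr_gt0 slt // (ltn_trans ij) // jk.
  near=> r; move=> _; rewrite /= mulr0n mulr1n mulr0 mulr1 addr0 -lerBrDl ltW //.
  by near: r; exact: lt_nbhsl.
near=> r.
have r0 : 0 <= s k ^+ 2 + r.
  rewrite -lerBlDl sub0r ltW //; near: r; apply: lt_nbhsr.
  by rewrite oppr_lt0 exprn_gt0.
(* The singular values of [c r]; squaring recovers [s k ^+ 2 + r] because this is nonnegative for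
   small [r]. *)
pose s' i := if i == k :> nat then Num.sqrt (s k ^+ 2 + r) else s i.
have cE : c r = sing_mx n p s'.
  apply/matrixP => a i; rewrite !mxE /s' -!(inj_eq val_inj) /= knk.
  have [ak|ak] := eqVneq (a : nat) k; last by rewrite mulr0 addr0.
  have [ik|ik] := eqVneq (i : nat) k; last first.
    by rewrite ak eq_sym (negPf ik) !mulr0n mulr0 addr0.
  by rewrite ak ik eqxx mulr1 !mulr1n subrKC.
apply: (spectral_decomposition_uniq (spectral (c r))).
split.
- exact: orthogonal_mx1.
- rewrite trmx1 mulmx1 mul1mx cE sing_mx_gram.
    congr diag_mx; apply/rowP => i; rewrite !mxE /s' eqxx /=.
    rewrite -(inj_eq val_inj) /=; case: eqP => [->|_].
      by rewrite sqr_sqrtr // mulr1 addrC.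
    by rewrite mulr0 add0r.
  move=> i ni; rewrite /s'; case: eqP => [ik|_]; last first.
    by apply: s0; rewrite geq_min ni.
  by move: ni; rewrite ik -knk leqNgt ltn_ord.
- move=> i j; rewrite leq_eqVlt => /predU1P[/val_inj -> //|ij].
  rewrite !mxE eqxx /= addrC [leRHS]addrC.
  by move: i j ij; near: r.
Unshelve. all: by end_near. Qed.

Let is_derive_c (r : R) : 0 < s k ^+ 2 + r ->
  is_derive r (1 : R) c ((2 * Num.sqrt (s k ^+ 2 + r))^-1 *: delta_mx kn k).
Proof.
move=> r0.
have dsq : is_derive r (1 : R) (fun t => Num.sqrt (s k ^+ 2 + t))
    (2 * Num.sqrt (s k ^+ 2 + r))^-1.
  have -> : (fun t => Num.sqrt (s k ^+ 2 + t)) = Num.sqrt \o (fun t => s k ^+ 2 + t).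
    by [].
  have := is_derive1_sqrt r0 => ?.
  apply: is_derive_eq; rewrite /GRing.scale /= add0r; ring.
have Hij i j : is_derive r (1 : R) (fun t => c t i j)
    (((2 * Num.sqrt (s k ^+ 2 + r))^-1 *: (delta_mx kn k : 'M[R]_(n, p))) i j).
  rewrite (_ : (fun t => _) = (fun t => sing_mx n p s i j +
      (Num.sqrt (s k ^+ 2 + t) - s k) * delta_mx kn k i j)); last first.
    by apply/funext => t; rewrite !mxE.
  apply: is_derive_eq; rewrite !mxE /GRing.scale /=; ring.
have dc : derivable c r 1.
  by apply/derivable_mxP => i j; case: (Hij i j).
by apply: DeriveDef; rewrite // derive_mx //; apply/matrixP => i j; rewrite mxE;
  case: (Hij i j).
Qed.

Let near_pos : \forall r \near (0 : R), 0 < s k ^+ 2 + r.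
Proof.
near=> r; rewrite -ltrBlDl sub0r; near: r; apply: lt_nbhsr.
by rewrite oppr_lt0 exprn_gt0.
Unshelve. all: by end_near. Qed.

Let near_diff : \forall r \near (0 : R), differentiable h (c r).
Proof.
have dc0 : differentiable c 0.
  by apply/derivable1_diffP; case: (is_derive_c (r := 0)); rewrite // addr0 exprn_gt0.
have [hd _] := dy; rewrite -c0 in hd.
exact: (differentiable_continuous dc0 hd).
Qed.

(** On the line of the [k]-th coordinate [H] equals [h \o c], to which the chain rule applies. A
    whole neighbourhood of 0 is needed because the formula is differentiated once more. *)
Lemma pderiv_near : \forall r \near (0 : R),
  pderiv H k (r *: delta_mx 0 k + l) =
  mgrad h (c r) kn k * (2 * Num.sqrt (s k ^+ 2 + r))^-1.
Proof.
(* To compare derivatives at [r] the functions must agree around [r], not just at it; [near_join]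
   gives this for all small [r]. *)
have HE : \forall r \near (0 : R), \forall u \near r,
    H (u *: delta_mx 0 k + l) = h (c u).
  apply: near_join.
  by near=> r; rewrite h_eq; congr H; apply/esym; near: r; exact: lam_sing_near.
near=> r.
rewrite /pderiv derive_line.
have E : \forall u \near r, H (u *: delta_mx 0 k + l) = h (c u) by near: r.
have r0 : 0 < s k ^+ 2 + r by near: r.
have hd : differentiable h (c r) by near: r.
rewrite (near_eq_derive _ E).
have [_ /= ->] := derive_comp_curve hd (is_derive_c r0).
by rewrite deriveE // linearZ -deriveE // mxE; exact: mulrC.
Unshelve. all: by end_near. Qed.

Lemma mgrad_sing_pderiv :
  mgrad h (sing_mx n p s) kn k = 2 * s k * pderiv H k l.
Proof.
have := nbhs_singleton pderiv_near.
rewrite scale0r add0r c0 addr0 sqrtr_sqr gtr0_norm // => ->.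
have sk1 : s k != 0 by rewrite gt_eqF.
by field.
Qed.

(** The product rule in [pderiv_near] at [r = 0] expresses the second derivative of [H] as the
    Hessian entry over [4 * s k ^+ 2] minus the gradient entry over [4 * s k ^+ 3]; this is solved
    for the Hessian entry. *)
Lemma hess_sing_pderiv :
  ('D_(delta_mx kn k) (mgrad h) (sing_mx n p s)) kn k =
  2 * pderiv H k l + 4 * s k ^+ 2 * pderiv (pderiv H k) k l.
Proof.
have [_ gd] := dy.
have r0 : 0 < s k ^+ 2 + 0 by rewrite addr0 exprn_gt0.
have E : pderiv (pderiv H k) k l =
    'D_1 (fun r => mgrad h (c r) kn k * (2 * Num.sqrt (s k ^+ 2 + r))^-1) 0.
  rewrite {1}/pderiv -[X in 'D_ _ _ X]add0r -(scale0r (delta_mx 0 k)) derive_line.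
  exact: near_eq_derive pderiv_near.
have gd0 : differentiable (mgrad h) (c 0) by rewrite c0.
have dg : is_derive (0 : R) (1 : R) (fun r => mgrad h (c r) kn k)
    ((2 * s k)^-1 * ('D_(delta_mx kn k) (mgrad h) (sing_mx n p s)) kn k).
  have dcomp := derive_comp_curve gd0 (is_derive_c r0).
  have [dd dE] := dcomp.
  apply: DeriveDef; first by move/derivable_mxP : dd.
  move: dE; rewrite derive_mx // => /matrixP/(_ kn k); rewrite mxE /= => ->.
  rewrite c0 addr0 sqrtr_sqr gtr0_norm // deriveE // linearZ -deriveE //.
  by rewrite mxE.
have dsq : is_derive (0 : R) (1 : R) (fun t => Num.sqrt (s k ^+ 2 + t)) (2 * s k)^-1.
  have -> : (fun t => Num.sqrt (s k ^+ 2 + t)) = Num.sqrt \o (fun t => s k ^+ 2 + t).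
    by [].
  have := is_derive1_sqrt r0 => ?.
  apply: is_derive_eq; rewrite /GRing.scale /= add0r addr0 sqrtr_sqr gtr0_norm //; ring.
have sk1 : s k != 0 by rewrite gt_eqF.
have sq0 : (fun t => 2 * Num.sqrt (s k ^+ 2 + t)) (0 : R) != 0.
  by rewrite /= addr0 sqrtr_sqr gtr0_norm // mulf_neq0 // pnatr_eq0.
have dinv : is_derive (0 : R) (1 : R) (fun t => (2 * Num.sqrt (s k ^+ 2 + t))^-1)
    (- (4 * s k ^+ 3)^-1).
  apply: is_derive_eq.
  rewrite /GRing.scale /= addr0 sqrtr_sqr gtr0_norm //; field.
  by [].
rewrite E (@derive_val _ _ _ _ _ _ _ (is_deriveM dg dinv)).
rewrite c0 mgrad_sing_pderiv addr0 sqrtr_sqr gtr0_norm // /GRing.scale /=.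
by field.
Qed.

End eigenvalue_derivatives.

(** * The matrix of second derivatives in the risk, and its equivariance *)

Section laplacian.
Context {R : realType}.

Definition grad_div (n p : nat) (h : 'M[R]_(n, p) -> R) (x : 'M[R]_(n, p)) : 'M[R]_p :=
  \matrix_(i, j) \sum_a ('D_(delta_mx a i) (mgrad h) x) a j.

Definition stein_mx (n p : nat) (h : 'M[R]_(n, p) -> R) (x : 'M[R]_(n, p)) : 'M[R]_p :=
  grad_div h x + (grad_div h x)^T + (mgrad h x)^T *m mgrad h x.

(** Serves to trade a sum over rows for one over columns: both reduce to the common range of
    indices. *)
Lemma sum_ord_support (n m : nat) (F : nat -> R) :
  (forall k, (minn n m <= k)%N -> F k = 0) ->
  \sum_(a < n) F a = \sum_(j < m) F j.
Proof.
have key n1 n2 : (n1 <= n2)%N -> (forall k, (n1 <= k)%N -> F k = 0) ->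
    \sum_(a < n1) F a = \sum_(a < n2) F a.
  move=> n12 F0; rewrite (big_ord_widen n2 F n12) [RHS](bigID (fun a : 'I_n2 => (a < n1)%N)) /=.
  by rewrite [X in _ + X]big1 ?addr0 // => a; rewrite -leqNgt => /F0.
by move=> F0; rewrite -(key (minn n m) n) ?geq_minl // (key (minn n m) m) ?geq_minr.
Qed.

(** The row index is summed over in each term, so [P] disappears through [P^T *m P = 1%:M]; the two
    free column indices each retain a factor [Q]. *)
Lemma stein_mx_orth (n p : nat) (h : 'M[R]_(n, p) -> R) (P : 'M[R]_n) (Q : 'M[R]_p)
    (y : 'M[R]_(n, p)) :
  orthogonally_invariant h -> orthogonal_mx P -> orthogonal_mx Q ->
  twice_differentiable h y ->
  stein_mx h (P *m y *m Q) = Q^T *m stein_mx h y *m Q.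
Proof.
move=> h_inv oP oQ dy; rewrite /stein_mx.
have hd := nbhs_singleton dy.1.
have gE : (mgrad h (P *m y *m Q))^T *m mgrad h (P *m y *m Q) =
    Q^T *m ((mgrad h y)^T *m mgrad h y) *m Q.
  rewrite mgrad_orth // !trmx_mul !mulmxA; congr (_ *m _ *m _).
  by rewrite -!mulmxA oP mulmx1.
have dE : grad_div h (P *m y *m Q) = Q^T *m grad_div h y *m Q.
  apply/matrixP => i j; rewrite mxE.
  pose A b k : 'M[R]_(n, p) := 'D_(delta_mx b k) (mgrad h) y.
  have E a : ('D_(delta_mx a i) (mgrad h) (P *m y *m Q)) a j =
      \sum_b \sum_k Q k i * (P^T b a * (P *m A b k *m Q) a j).
    rewrite -{1}(orthlrVK (delta_mx a i) oP oQ).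
    rewrite (twice_differentiable_orth h_inv _ oP oQ dy).2.
    rewrite derive_sum_delta; last exact: dy.2.
    rewrite mulmx_sumr mulmx_suml summxE; apply: eq_bigr => b _.
    rewrite mulmx_sumr mulmx_suml summxE; apply: eq_bigr => k _ /=.
    rewrite -scalemxAr -scalemxAl [LHS]mxE mul_delta_mxlr [Q^T _ _]mxE /A.
    by rewrite mulrA [_ * Q k i]mulrC.
  under eq_bigr do rewrite E; rewrite exchange_big /=.
  under eq_bigr => b _.
    rewrite exchange_big /=; under eq_bigr => k _.
      rewrite -mulr_sumr.
      have -> : \sum_a P^T b a * (P *m A b k *m Q) a j = (A b k *m Q) b j.
        by rewrite -[in RHS](mul1mx (A b k)) -oP -!mulmxA [RHS]mxE !mulmxA.
      over.
    over.
  rewrite /= exchange_big /= -mulmxA mxE; apply: eq_bigr => k _.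
  rewrite -mulr_sumr [Q^T _ _]mxE; congr (_ * _); rewrite [RHS]mxE.
  under [RHS]eq_bigr do rewrite mxE mulr_suml.
  by rewrite [RHS]exchange_big /=; apply: eq_bigr => b _; rewrite mxE.
by rewrite gE dE !(mulmxDl, mulmxDr) !trmx_mul trmxK !mulmxA.
Qed.

End laplacian.

Section laplacian_sing.
Context {R : realType} {n p : nat}.
Variables (h : 'M[R]_(n, p) -> R) (H : 'rV[R]_p -> R).
Variables (lam : 'M[R]_(n, p) -> 'rV[R]_p) (V : 'M[R]_(n, p) -> 'M[R]_p).
Hypothesis h_inv : orthogonally_invariant h.
Hypothesis spectral : forall x : 'M[R]_(n, p),
  spectral_decomposition (x^T *m x) (V x) (lam x).
Hypothesis h_eq : forall x, h x = H (lam x).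
Variable s : nat -> R.
Hypothesis s0 : forall k, (minn n p <= k)%N -> s k = 0.
Hypothesis s_gt0 : forall k, (k < minn n p)%N -> 0 < s k.
Hypothesis s_decr : forall i j, (i < j)%N -> (j < minn n p)%N -> s j < s i.
Hypothesis dy : twice_differentiable h (sing_mx n p s).

Let l : 'rV[R]_p := \row_k s k ^+ 2.
(** Partial derivatives indexed by [nat], since they are read at row indices that may exceed [p].
    The default value is harmless: it only occurs with the factor [s a ^+ 2], which is 0 there. *)
Let H1 (i : nat) : R := if insub i is Some k then pderiv H k l else 0.

Let H1E (k : 'I_p) : H1 k = pderiv H k l.
Proof. by rewrite /H1 valK. Qed.

Let sqr_neq i j : i != j -> (i < minn n p)%N -> (j < minn n p)%N ->
  s i ^+ 2 - s j ^+ 2 != 0.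
Proof.
rewrite neq_ltn => /orP[] ij im jm; rewrite subr_eq0.
  by rewrite gt_eqF // ltrXn2r ?nnegrE ?ltW // ?s_gt0 // s_decr.
by rewrite lt_eqF // ltrXn2r ?nnegrE ?ltW // ?s_gt0 // s_decr.
Qed.

Let solve_skew_pair (u v x z Hu Hv : R) : u ^+ 2 - v ^+ 2 != 0 ->
  u * x - v * z = 2 * u * Hu -> v * x - u * z = 2 * v * Hv ->
  x = 2 * Hu + 2 * (v ^+ 2 / (u ^+ 2 - v ^+ 2) * (Hu - Hv)).
Proof.
move=> uv E1 E2; apply: (mulfI uv).
(* The combination that eliminates [z] from the two equations. *)
transitivity (u * (u * x - v * z) - v * (v * x - u * z)); first by ring.
by rewrite E1 E2; field.
Qed.

Lemma hess_sing_diag (a : 'I_n) (i : 'I_p) :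
  ('D_(delta_mx a i) (mgrad h) (sing_mx n p s)) a i =
  2 * pderiv H i l +
  2 * (s a ^+ 2 / (s i ^+ 2 - s a ^+ 2) * (pderiv H i l - H1 a)) +
  (if a == i :> nat then 4 * s i ^+ 2 * pderiv (pderiv H i) i l else 0).
Proof.
have [ai|ai] := eqVneq (a : nat) i.
  rewrite (hess_sing_pderiv spectral h_eq s0 s_gt0 s_decr dy ai).
  (* For [a = i] the quotient has denominator 0 and vanishes by convention, so one formula covers
     all rows. *)
  by rewrite ai subrr invr0 mulr0 mul0r mulr0 addr0.
(* Here [a < n <= i]: there is no row [i] to rotate with. Since [s i = 0], the column equation alone
   determines the derivative. *)
rewrite addr0; have [ni|ni] := leqP n i.
  have ap : (a < p)%N by rewrite (leq_trans (ltn_ord a)) // (leq_trans ni) // ltnW.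
  have si : s i = 0 by rewrite s0 // geq_min ni.
  have am : (a < minn n p)%N by rewrite leq_min ltn_ord ap.
  have sa : s a != 0 by rewrite gt_eqF // s_gt0.
  have Ha := H1E (Ordinal ap); rewrite /= in Ha.
  have := hess_sing_skewr h_inv dy (a := a) (a' := Ordinal ap) (i := i) erefl ai.
  rewrite (mgrad_sing_pderiv spectral h_eq s0 s_gt0 s_decr dy) //=.
  rewrite si mul0r subr0 expr0n /= sub0r -mulrA [2 * _]mulrCA.
  move=> /(mulfI sa) ->; rewrite Ha; field.
  exact: sa.
have im : (i < minn n p)%N by rewrite leq_min ltn_ord andbT.
have si : s i != 0 by rewrite gt_eqF // s_gt0.
have := hess_sing_skewl h_inv dy (a := a) (i := i) (i' := Ordinal ni) erefl ai.
rewrite (mgrad_sing_pderiv spectral h_eq s0 s_gt0 s_decr dy) //=.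
(* If [p <= a] there is no column [a], but [s a = 0] and the row equation suffices. Otherwise both
   equations are available and form a nonsingular system. *)
have [pa|ap] := leqP p a.
  have sa : s a = 0 by rewrite s0 // geq_min pa orbT.
  rewrite sa !mul0r subr0 expr0n /= !mul0r mulr0 addr0 -mulrA [2 * _]mulrCA.
  by move/(mulfI si).
have am : (a < minn n p)%N by rewrite leq_min ltn_ord ap.
have Ha := H1E (Ordinal ap); rewrite /= in Ha.
have := hess_sing_skewr h_inv dy (a := a) (a' := Ordinal ap) (i := i) erefl ai.
rewrite (mgrad_sing_pderiv spectral h_eq s0 s_gt0 s_decr dy) //=.
have ia : s i ^+ 2 - s a ^+ 2 != 0 by apply: sqr_neq => //; rewrite eq_sym.
rewrite Ha => E2 E1; exact: solve_skew_pair ia E1 E2.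
Qed.

(** On the diagonal, twice the sum of [hess_sing_diag] over the rows gives the three terms of
    [Ddiag] that are linear in [H], and the squared gradient gives the quadratic one. *)
Lemma stein_mx_sing :
  stein_mx h (sing_mx n p s) = diag_mx (Ddiag n H l).
Proof.
have hd := nbhs_singleton dy.1.
have gii (a : 'I_n) (i : 'I_p) : a = i :> nat ->
    mgrad h (sing_mx n p s) a i = 2 * s i * pderiv H i l.
  by move=> ai; rewrite (mgrad_sing_pderiv spectral h_eq s0 s_gt0 s_decr dy).
apply/matrixP => i j; rewrite !mxE.
have [->|ij] := eqVneq i j; last first.
  rewrite [RHS]mulr0n !big1 ?addr0 //= => a _.
  - have [ai|ai] := eqVneq (a : nat) i.
      rewrite [X in _ * X](mgrad_sing_offdiag h_inv dy) ?mulr0 // ai.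
      by rewrite (inj_eq val_inj).
    by rewrite mxE (mgrad_sing_offdiag h_inv dy) ?mul0r.
  - by rewrite (hess_sing_offdiag h_inv dy) // eq_sym.
  - by rewrite (hess_sing_offdiag h_inv dy).
have gsum : \sum_a (mgrad h (sing_mx n p s))^T j a * mgrad h (sing_mx n p s) a j =
    4 * s j ^+ 2 * pderiv H j l ^+ 2.
  have [nj|jn] := leqP n j.
    rewrite (s0 (k := j)) ?geq_min ?nj // expr0n /= mulr0 mul0r big1 // => a _.
    rewrite mxE (mgrad_sing_offdiag h_inv dy) ?mul0r // neq_ltn.
    by rewrite (leq_trans (ltn_ord a)).
  rewrite (bigD1 (Ordinal jn)) //= big1 ?addr0; last first.
    move=> a; rewrite -(inj_eq val_inj) /= => aj.
    by rewrite mxE (mgrad_sing_offdiag h_inv dy) ?mul0r.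
  by rewrite mxE gii //; ring.
have hsum : \sum_a ('D_(delta_mx a j) (mgrad h) (sing_mx n p s)) a j =
    2 * n%:R * pderiv H j l +
    2 * \sum_(k < p | k != j) l 0 k / (l 0 j - l 0 k) * (pderiv H j l - pderiv H k l) +
    4 * s j ^+ 2 * pderiv (pderiv H j) j l.
  under eq_bigr do rewrite hess_sing_diag.
  rewrite !big_split /= sumr_const card_ord -mulr_sumr.
  (* The sum runs over rows but [Ddiag] sums over columns; the factor [s a ^+ 2] kills every term
     past [minn n p]. *)
  rewrite (@sum_ord_support _ n p
    (fun a => s a ^+ 2 / (s j ^+ 2 - s a ^+ 2) * (pderiv H j l - H1 a))); last first.
    by move=> k /s0 ->; rewrite expr0n /= !mul0r.
  congr (_ + _ + _).
  - by rewrite -mulr_natr; ring.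
  - congr (_ * _); rewrite [LHS](bigD1 j) //= subrr invr0 mulr0 mul0r add0r.
    by apply: eq_bigr => k kj; rewrite !mxE H1E.
  (* The second derivative of [H] enters through the row of index [j] only; if there is no such row,
     then [s j = 0] and the term on the right vanishes too. *)
  rewrite -big_mkcond /=; have [nj|jn] := leqP n j.
    by rewrite (s0 (k := j)) ?geq_min ?nj // expr0n /= mulr0 mul0r big1.
  rewrite (bigD1 (Ordinal jn)) //= big1 ?addr0 // => a /andP[/eqP aj /negP[]].
  exact/eqP/val_inj.
rewrite gsum hsum mulr1n mxE; ring.
Qed.

End laplacian_sing.

(** * Singular values and the pointwise identity *)

Section svd.
Context {R : realType}.

(** Induction on the number of missing columns: a unit vector orthogonal to the first [m] columns is
    put in the next position. *)
Lemma orthogonal_completion (n m : nat) (A : 'M[R]_n) : (m <= n)%N ->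
  (forall i j : 'I_n, (i < m)%N -> (j < m)%N -> (A^T *m A) i j = (i == j)%:R) ->
  exists U : 'M[R]_n, orthogonal_mx U /\
    forall i j : 'I_n, (j < m)%N -> U i j = A i j.
Proof.
have [d] := ubnP (n - m)%N; elim: d m A => // d IH m A dm mn AA.
have [nm|{}mn] := leqP n m.
  exists A; split=> //; apply/matrixP => i j; rewrite [RHS]mxE AA //.
    by rewrite (leq_trans (ltn_ord _)).
  by rewrite (leq_trans (ltn_ord _)).
(* [B] keeps the first [m] columns and zeroes the others. Its rank is at most [m < n], so some
   nonzero [v] has [v *m B = 0], that is, is orthogonal to those columns. *)
pose B := A *m pid_mx m : 'M[R]_n.
have rB : (\rank B <= m)%N.
  apply: (leq_trans (mxrankM_maxr A (pid_mx m))).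
  by rewrite rank_pid_mx; [|exact: ltnW|exact: ltnW].
have /rowV0Pn[v /sub_kermxP vB v0] : kermx B != 0.
  rewrite -mxrank_eq0 mxrank_ker subn_eq0 -ltnNge.
  exact: leq_ltn_trans rB mn.
have vA (j : 'I_n) : (j < m)%N -> \sum_i v 0 i * A i j = 0.
  move=> jm; have /rowP/(_ j) := vB; rewrite /B mulmxA !mxE (bigD1 j) //= big1 ?addr0.
    by rewrite !mxE eqxx jm mulr1.
  by move=> k kj; rewrite !mxE (inj_eq val_inj) (negPf kj) mulr0.
pose N := \sum_i v 0 i ^+ 2.
have N0 : 0 < N.
  rewrite lt_neqAle sumr_ge0 ?andbT; last by move=> i _; exact: sqr_ge0.
  apply: contraNneq v0 => /esym/psumr_eq0P N0; apply/eqP/rowP => i.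
  by rewrite mxE; apply/eqP; rewrite -sqrf_eq0 N0 // => j _; exact: sqr_ge0.
pose om : 'I_n := Ordinal mn.
pose A' : 'M[R]_n := \matrix_(i, j) if j == om then v 0 i / Num.sqrt N else A i j.
have [||U [oU UA]] := IH m.+1 A' _ mn.
- by rewrite subnS -ltnS prednK ?subn_gt0.
- move=> i j; rewrite !ltnS => im jm; rewrite mxE.
  under eq_bigr do rewrite !mxE.
  have [io|io] := eqVneq i om; have [jo|jo] := eqVneq j om.
  + rewrite io jo eqxx; under eq_bigr do rewrite mulrACA -expr2.
    rewrite -mulr_suml -/N -invfM -expr2 sqr_sqrtr ?ltW // divff ?gt_eqF //.
  + have {}jm : (j < m)%N by rewrite ltn_neqAle jm andbT -(inj_eq val_inj) in jo *.
    rewrite io eq_sym (negPf jo); under eq_bigr do rewrite mulrAC.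
    by rewrite -mulr_suml vA // mul0r.
  + have {}im : (i < m)%N by rewrite ltn_neqAle im andbT -(inj_eq val_inj) in io *.
    rewrite jo (negPf io); under eq_bigr do rewrite mulrA [A _ _ * _]mulrC.
    by rewrite -mulr_suml vA // mul0r.
  + have {}im : (i < m)%N by rewrite ltn_neqAle im andbT -(inj_eq val_inj) in io *.
    have {}jm : (j < m)%N by rewrite ltn_neqAle jm andbT -(inj_eq val_inj) in jo *.
    by rewrite -AA // mxE; apply: eq_bigr => k _; rewrite mxE.
exists U; split=> // i j jm; rewrite UA ?mxE; last exact: ltnW.
by case: eqP => // jo; rewrite jo ltnn in jm.
Qed.

Lemma gram_orth_conj (n p : nat) (x : 'M[R]_(n, p)) (V : 'M[R]_p) (l : 'rV[R]_p) :
  orthogonal_mx V -> x^T *m x = V *m diag_mx l *m V^T ->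
  (x *m V)^T *m (x *m V) = diag_mx l.
Proof.
move=> oV xx; rewrite trmx_mul -!mulmxA (mulmxA x^T) xx !mulmxA oV mul1mx.
by rewrite -mulmxA oV mulmx1.
Qed.

Lemma gram_diag_sum (n p : nat) (y : 'M[R]_(n, p)) (l : 'rV[R]_p) (k : 'I_p) :
  y^T *m y = diag_mx l -> l 0 k = \sum_a y a k ^+ 2.
Proof.
move/matrixP => /(_ k k); rewrite !mxE eqxx mulr1n => <-.
by apply: eq_bigr => a _; rewrite mxE expr2.
Qed.

(** If [l 0 k] were positive with [n <= k], the order would make the first [n.+1] values positive,
    and the first [n.+1] columns of [y] would have an invertible Gram matrix although they live in
    dimension [n]. *)
Lemma gram_diag_rank (n p : nat) (y : 'M[R]_(n, p)) (l : 'rV[R]_p) (k : 'I_p) :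
  y^T *m y = diag_mx l -> (forall i j : 'I_p, (i <= j)%N -> l 0 j <= l 0 i) ->
  (n <= k)%N -> l 0 k = 0.
Proof.
move=> yy sl nk; have l0 : 0 <= l 0 k.
  by rewrite (gram_diag_sum k yy) sumr_ge0 // => a _; exact: sqr_ge0.
apply/eqP; rewrite eq_le l0 andbT.
rewrite leNgt; apply/negP => lk0.
have np : (n.+1 <= p)%N by rewrite (leq_ltn_trans nk).
pose z : 'M[R]_(n, n.+1) := \matrix_(a, i) y a (widen_ord np i).
pose l' : 'rV[R]_n.+1 := \row_i l 0 (widen_ord np i).
have zz : z^T *m z = diag_mx l'.
  apply/matrixP => i j; move/matrixP : yy => /(_ (widen_ord np i) (widen_ord np j)).
  rewrite !mxE -[widen_ord np i == _]/(i == j) => <-.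
  by apply: eq_bigr => a _; rewrite !mxE.
have : (z^T *m z) \in unitmx.
  rewrite zz unitmxE det_diag unitfE; apply/prodf_neq0 => i _; rewrite mxE gt_eqF //.
  apply: lt_le_trans lk0 _; apply: sl; rewrite /= (leq_trans _ nk) //.
  by rewrite -ltnS.
move/mxrank_unit => rz; have := leq_trans (mxrankM_maxr z^T z) (rank_leq_row z).
by rewrite rz ltnn.
Qed.

(** The columns of [x *m V] are orthogonal with norms [s k]. The first [minn n p] of them,
    normalised, are completed to [U]; any further column has norm 0. *)
Lemma svd_sing (n p : nat) (x : 'M[R]_(n, p)) (V : 'M[R]_p) (s : nat -> R) :
  orthogonal_mx V ->
  x^T *m x = V *m diag_mx (\row_k s k ^+ 2) *m V^T ->
  (forall k, (minn n p <= k)%N -> s k = 0) ->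
  (forall k, (k < minn n p)%N -> 0 < s k) ->
  exists2 U, orthogonal_mx U & x = U *m sing_mx n p s *m V^T.
Proof.
move=> oV xx s0 s_gt0; have yy := gram_orth_conj oV xx.
set y := x *m V in yy.
pose A : 'M[R]_n := \matrix_(i, j) if insub (j : nat) is Some k then y i k / s j else 0.
have [||U [oU UA]] := @orthogonal_completion n (minn n p) A; first exact: geq_minl.
  move=> i j im jm; rewrite mxE.
  have ip : (i < p)%N by apply: leq_trans im _; exact: geq_minr.
  have jp : (j < p)%N by apply: leq_trans jm _; exact: geq_minr.
  under eq_bigr do rewrite !mxE !insubT /= mulrACA.
  rewrite -mulr_suml; move/matrixP : yy => /(_ (Sub (i : nat) ip) (Sub (j : nat) jp)).
  rewrite mxE; under eq_bigr do rewrite mxE; move=> ->; rewrite !mxE /=.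
  rewrite -(inj_eq val_inj) /= -(inj_eq val_inj) /=.
  case: eqP => [ij|_]; last by rewrite mulr0n mul0r.
  have := s_gt0 _ jm; rewrite ij => sj; rewrite mulr1n -invfM -expr2 divff //.
  by rewrite sqrf_eq0 gt_eqF.
exists U => //.
suff -> : U *m sing_mx n p s = y by rewrite /y -mulmxA orthogonal_mxK // mulmx1.
apply/matrixP => i k; rewrite mxE.
have [nk|kn] := leqP n k.
  have := gram_diag_sum k yy; rewrite mxE s0 ?geq_min ?nk // expr0n /= => /esym.
  move/psumr_eq0P => y0.
  have /eqP := y0 (fun a _ => sqr_ge0 _) i isT; rewrite sqrf_eq0 => /eqP ->.
  rewrite big1 // => a _; rewrite mxE; case: eqP => [ak|_]; last by rewrite mulr0.
  by have := ltn_ord a; rewrite ak ltnNge nk.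
rewrite (bigD1 (Ordinal kn)) //= big1 ?addr0; last first.
  by move=> a; rewrite -(inj_eq val_inj) mxE /= => /negPf ->; rewrite mulr0.
have km : (k < minn n p)%N by rewrite leq_min kn ltn_ord.
rewrite UA // !mxE /= eqxx mulr1n valK divfK; first by rewrite /y mxE.
by rewrite gt_eqF // s_gt0.
Qed.

End svd.

Section gram_discriminant.

(* The determinant of a Hankel matrix of power sums of the eigenvalues of
   [x^T *m x]: a polynomial in the entries of [x] equal to the product of the
   first [minn n p] eigenvalues and of their squared Vandermonde determinant. *)
Definition gram_disc (S : comNzRingType) (n p : nat) (x : 'M[S]_(n, p)) : S :=
  \det (\matrix_(i < minn n p, j < minn n p)
    \tr (iter (i + j) (mulmx (x^T *m x)) (x^T *m x))).

(** With [f] an evaluation map, this is what shows [gram_disc] to be polynomial along lines: it can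
    be computed over [{poly R}] first. *)
Lemma map_gram_disc (S S' : comNzRingType) (f : {rmorphism S -> S'}) (n p : nat)
    (x : 'M[S]_(n, p)) : f (gram_disc x) = gram_disc (map_mx f x).
Proof.
rewrite /gram_disc -det_map_mx; congr (\det _); apply/matrixP => i j; rewrite !mxE.
rewrite -trace_map_mx; congr (\tr _).
elim: (i + j)%N => [|m IH] /=; first by rewrite map_mxM map_trmx.
by rewrite map_mxM IH map_mxM map_trmx.
Qed.

Context {R : realType} {n p : nat}.

(** The Hankel matrix factors as Vandermonde, diagonal, transposed Vandermonde. The iterate of order
    [i + j] is the power [i + j + 1] of the Gram matrix; the extra one produces the diagonal
    factor. *)
Lemma gram_disc_eigen (x : 'M[R]_(n, p)) (V : 'M[R]_p) (l : 'rV[R]_p) :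
  orthogonal_mx V -> x^T *m x = V *m diag_mx l *m V^T ->
  (forall k : 'I_p, (n <= k)%N -> l 0 k = 0) ->
  let a : 'rV[R]_(minn n p) := \row_k l 0 (widen_ord (geq_minr n p) k) in
  gram_disc x = (\prod_(i < minn n p) \prod_(j < minn n p | (i < j)%N)
    (a 0 j - a 0 i)) ^+ 2 * \prod_i a 0 i.
Proof.
move=> oV xx l0 a; rewrite -det_Vandermonde -det_diag.
rewrite expr2 mulrAC -[X in _ * _ * X]det_tr -!det_mulmx; congr (\det _).
apply/matrixP => i j; rewrite mxE xx.
have -> m : iter m (mulmx (V *m diag_mx l *m V^T)) (V *m diag_mx l *m V^T) =
    V *m diag_mx (\row_k l 0 k ^+ m.+1) *m V^T.
  elim: m => [|m IH] /=.
    by congr (_ *m diag_mx _ *m _); apply/rowP => k; rewrite mxE.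
  rewrite IH !mulmxA -[V *m diag_mx l *m V^T *m V]mulmxA oV mulmx1.
  congr (_ *m _); rewrite -!mulmxA; congr (_ *m _); rewrite mul_diag_mx.
  apply/matrixP => b c; rewrite !mxE.
  by rewrite mulrnAr -exprS.
rewrite mxtrace_mulC mulmxA oV mul1mx mxtrace_diag.
rewrite [RHS]mxE; under [RHS]eq_bigr do rewrite mul_mx_diag !mxE.
(* The trace sums over all [p] eigenvalues. The exponent is positive, so those past [minn n p],
   being 0, contribute nothing. *)
pose F k := if insub k is Some o then l 0 o ^+ (i + j).+1 else 0 : R.
have FE (k : 'I_p) : F k = l 0 k ^+ (i + j).+1 by rewrite /F valK.
under [LHS]eq_bigr do rewrite mxE -FE.
rewrite -(@sum_ord_support _ (minn n p) p F); last first.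
  rewrite -minnA minnn => k; rewrite /F; case: insubP => // o _ <- nk.
  by rewrite l0 ?expr0n //; move: nk; rewrite geq_min => /orP[//|]; rewrite leqNgt ltn_ord.
apply: eq_bigr => k _; rewrite -[X in F X]/(widen_ord (geq_minr n p) k : nat) FE.
by rewrite -exprSr -exprD addSn.
Qed.

Lemma gram_disc_neq0 (x : 'M[R]_(n, p)) (V : 'M[R]_p) (l : 'rV[R]_p) :
  orthogonal_mx V -> x^T *m x = V *m diag_mx l *m V^T ->
  (forall k : 'I_p, (n <= k)%N -> l 0 k = 0) ->
  gram_disc x != 0 ->
  (forall k : 'I_p, (k < minn n p)%N -> l 0 k != 0) /\
  (forall i j : 'I_p, (i < j)%N -> (j < minn n p)%N -> l 0 i != l 0 j).
Proof.
move=> oV xx l0; rewrite (gram_disc_eigen oV xx l0) mulf_eq0 negb_or expf_eq0 /=.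
move=> /andP[/prodf_neq0 disc /prodf_neq0 nz]; split=> [k km|i j ij jm].
  have := nz (Ordinal km) isT; rewrite mxE.
  by congr (l 0 _ != 0); apply: val_inj.
have im := ltn_trans ij jm.
have /prodf_neq0/(_ (Ordinal jm) ij) := disc (Ordinal im) isT.
rewrite !mxE subr_eq0 eq_sym.
by congr (l 0 _ != l 0 _); apply: val_inj.
Qed.

Lemma gram_disc_witness : exists x : 'M[R]_(n, p), gram_disc x != 0.
Proof.
(* Distinct nonzero singular values. They increase, which is allowed: [gram_disc_eigen] asks for an
   orthogonal diagonalisation in any order. *)
pose s k : R := if (k < minn n p)%N then k.+1%:R else 0.
exists (sing_mx n p s).
have s0 k : (n <= k)%N -> s k = 0.
  by move=> nk; rewrite /s ltnNge geq_min nk.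
have E : (sing_mx n p s)^T *m sing_mx n p s =
    1%:M *m diag_mx (\row_k s k ^+ 2) *m 1%:M^T.
  by rewrite sing_mx_gram // trmx1 mulmx1 mul1mx.
rewrite (gram_disc_eigen (@orthogonal_mx1 _ _) E); last first.
  by move=> k nk; rewrite mxE s0 // expr0n.
rewrite mulf_neq0 // ?sqrf_eq0; apply/prodf_neq0 => i _.
  apply/prodf_neq0 => j ij; rewrite !mxE /= /s !ltn_ord subr_eq0 gt_eqF //.
  by rewrite ltrXn2r ?nnegrE // ltr_nat ltnS.
by rewrite !mxE /= /s ltn_ord sqrf_eq0 pnatr_eq0.
Qed.

Lemma gram_disc_line (x : 'M[R]_(n, p)) (v : 'M[R]_(n, p)) :
  exists P : {poly R}, forall u, gram_disc (x + u *: v) = P.[u].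
Proof.
exists (gram_disc (map_mx polyC x + 'X *: map_mx polyC v)) => u.
rewrite -[RHS]/(horner_eval u _) map_gram_disc; congr gram_disc.
apply/matrixP => i j; rewrite !mxE.
by rewrite rmorphD rmorphM /= /horner_eval hornerX !hornerC.
Qed.

End gram_discriminant.

Section pointwise_identity.
Context {R : realType} {n p : nat}.
Variables (h : 'M[R]_(n, p) -> R) (H : 'rV[R]_p -> R).
Variables (lam : 'M[R]_(n, p) -> 'rV[R]_p) (V : 'M[R]_(n, p) -> 'M[R]_p).
Hypothesis h_inv : orthogonally_invariant h.
Hypothesis spectral : forall x : 'M[R]_(n, p),
  spectral_decomposition (x^T *m x) (V x) (lam x).
Hypothesis h_eq : forall x, h x = H (lam x).

Lemma stein_mx_spectral (x : 'M[R]_(n, p)) :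
  twice_differentiable h x -> gram_disc x != 0 ->
  stein_mx h x = V x *m diag_mx (Ddiag n H (lam x)) *m (V x)^T.
Proof.
move=> dx disc; have [oV xx sl] := spectral x.
have yy := gram_orth_conj oV xx.
have l_ge0 k : 0 <= lam x 0 k.
  by rewrite (gram_diag_sum k yy) sumr_ge0 // => a _; exact: sqr_ge0.
have l0 (k : 'I_p) : (n <= k)%N -> lam x 0 k = 0 by exact: gram_diag_rank yy sl.
have [lnz lneq] := gram_disc_neq0 oV xx l0 disc.
pose s k := if insub k is Some o then Num.sqrt (lam x 0 o) else 0.
have sE (k : 'I_p) : s k = Num.sqrt (lam x 0 k) by rewrite /s valK.
have lE : lam x = \row_k s k ^+ 2.
  by apply/rowP => k; rewrite mxE sE sqr_sqrtr.
have s0 k : (minn n p <= k)%N -> s k = 0.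
  rewrite /s; case: insubP => // o _ <-; rewrite geq_min => /orP[no|].
    by rewrite l0 // sqrtr0.
  by rewrite leqNgt ltn_ord.
have s_gt0 k : (k < minn n p)%N -> 0 < s k.
  move=> km; have kp : (k < p)%N by rewrite (leq_trans km) // geq_minr.
  rewrite -[k]/(Ordinal kp : nat) sE sqrtr_gt0 lt_neqAle l_ge0 andbT eq_sym.
  exact: lnz.
have s_decr i j : (i < j)%N -> (j < minn n p)%N -> s j < s i.
  move=> ij jm; have jp : (j < p)%N by rewrite (leq_trans jm) // geq_minr.
  have ip := ltn_trans ij jp.
  rewrite -[i]/(Ordinal ip : nat) -[j in s j]/(Ordinal jp : nat) !sE ltr_sqrt.
    rewrite lt_neqAle sl ?andbT; last exact: ltnW.
    by rewrite eq_sym lneq.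
  rewrite lt_neqAle l_ge0 andbT eq_sym; apply: lnz.
  exact: ltn_trans jm.
have xx' := xx; rewrite lE in xx'.
have [U oU xE] := svd_sing oV xx' s0 s_gt0.
have oVT := orthogonal_mx_tr oV.
have yE : sing_mx n p s = U^T *m x *m V x.
  by have := orthlrK (sing_mx n p s) oU oVT; rewrite trmxK -xE.
(* Smoothness at [x] is carried along its orbit to the diagonal point; the direction [0] is a
   dummy. *)
have dy : twice_differentiable h (sing_mx n p s).
  rewrite yE; exact: (twice_differentiable_orth h_inv 0 (orthogonal_mx_tr oU) oV dx).1.
rewrite {1}xE stein_mx_orth // trmxK; congr (_ *m _ *m _).
by rewrite lE; exact: stein_mx_sing.
Qed.

End pointwise_identity.

(** * The law of a random matrix *)

Section borel_matrices.
Context {R : realType} {n p : nat}.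
Notation BM := (borel_mx R n p).

Definition mx_box (B : 'I_n -> 'I_p -> set R) : set 'M[R]_(n, p) :=
  [set x | forall a i, B a i (x a i)].

Definition mx_boxes : set (set 'M[R]_(n, p)) :=
  [set mx_box B | B in [set B | forall a i, measurable (B a i)]].

Lemma measurable_continuous_mx (f : 'M[R]_(n, p) -> R) :
  continuous f -> measurable_fun [set: BM] (f : BM -> R).
Proof.
move=> cf; apply: (measurability _ (RGenOpens.measurableE R)) => _ [_ [a [b ->]] <-].
rewrite setTI; apply: sub_sigma_algebra; rewrite /=.
by move/continuousP : cf; apply; exact: interval_open.
Qed.

Lemma measurable_entry (a : 'I_n) (i : 'I_p) :
  measurable_fun [set: BM] (fun x : BM => x a i : R).
Proof.
by apply: measurable_continuous_mx => x; exact: coord_continuous.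
Qed.

Lemma measurable_mx_box (B : 'I_n -> 'I_p -> set R) :
  (forall a i, measurable (B a i)) -> measurable (mx_box B : set BM).
Proof.
move=> mB.
have -> : mx_box B = \bigcap_(a in [set: 'I_n]) \bigcap_(i in [set: 'I_p])
    ((fun x : BM => x a i : R) @^-1` B a i).
  by apply/seteqP; split => x Bx a => [_ i _|i]; [exact: Bx|exact: (Bx a _ i)].
apply: fin_bigcap_measurable; first exact: finite_finset.
move=> a _; apply: fin_bigcap_measurable; first exact: finite_finset.
by move=> i _; rewrite -[X in measurable X]setTI; apply: measurable_entry.
Qed.

(** Balls for the entrywise maximum distance are boxes, and those with rational centre and radius
    the inverse of a positive integer are countably many. *)
Lemma open_mx_bigcup (U : set 'M[R]_(n, p)) : open U ->
  U = \bigcup_(qk in [set qk : 'M[rat]_(n, p) * nat |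
        ball (map_mx ratr qk.1 : 'M[R]_(n, p)) (qk.2.+1%:R^-1) `<=` U])
      mx_box (fun a i => ball (ratr (qk.1 a i) : R) (qk.2.+1%:R^-1)).
Proof.
move=> oU; apply/seteqP; split => [x Ux|x [[q k] /= qkU bx]]; last first.
  apply: qkU; split; first by rewrite invr_gt0.
  by move=> a i; rewrite mxE; exact: bx.
have /nbhs_ballP[e /= e0 xeU] : nbhs x U by exact: open_nbhs_nbhs.
pose k := Num.bound (2 / e).
(* The centre is only within one radius of [x], so two radii have to fit into the ball around
   [x]. *)
have ke : 2 * k.+1%:R^-1 < e.
  rewrite ltr_pdivrMr // mulrC -ltr_pdivrMr //.
  by rewrite (lt_trans (archi_boundP _)) ?ltr_nat // divr_ge0 // ltW.
have k0 : (0 : R) < k.+1%:R^-1 by rewrite invr_gt0.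
have /choice[q qx] : forall ai : 'I_n * 'I_p, exists r : rat,
    `|x ai.1 ai.2 - ratr r| < k.+1%:R^-1 :> R.
  move=> ai; have /rat_in_itvoo[r] :
      x ai.1 ai.2 - k.+1%:R^-1 < x ai.1 ai.2 + k.+1%:R^-1.
    by rewrite ltrD2l gt0_cp.
  rewrite in_itv /= => /andP[r1 r2]; exists r.
  by rewrite distrC ltr_distl r1 r2.
exists (\matrix_(a, i) q (a, i), k).
  move=> /= y [_ bqy]; apply: xeU; split=> // a i; have := bqy a i.
  rewrite !mxE /ball /= => qy; apply: le_lt_trans ke.
  rewrite (le_trans (ler_distD (ratr (q (a, i))) _ _)) // mulr2n mulrDl mul1r.
  by rewrite lerD // ltW // (qx (a, i)).
by move=> a i; rewrite mxE /ball /= distrC; exact: (qx (a, i)).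
Qed.

Lemma measurable_to_mx d (T : measurableType d) (f : T -> BM) :
  (forall a i, measurable_fun [set: T] (fun w => f w a i : R)) ->
  measurable_fun [set: T] f.
Proof.
move=> mf.
have mE : @measurable _ BM = <<s @open 'M[R]_(n, p) >> by [].
refine (@measurability _ _ T BM setT f (@open 'M[R]_(n, p)) mE _).
move=> _ [U oU <-]; rewrite setTI (open_mx_bigcup oU) bigcup_mkcond preimage_bigcup.
apply: countable_bigcupT_measurable => [|[q k]]; first exact: countableP.
case: ifPn => _; last by rewrite preimage_set0.
set B := fun _ _ => _.
have -> : f @^-1` mx_box B = \bigcap_(a in [set: 'I_n]) \bigcap_(i in [set: 'I_p])
    ((fun w => f w a i : R) @^-1` B a i).
  by apply/seteqP; split => x Bx a => [_ i _|i]; [exact: Bx|exact: (Bx a _ i)].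
apply: fin_bigcap_measurable; first exact: finite_finset.
move=> a _; apply: fin_bigcap_measurable; first exact: finite_finset.
move=> i _; rewrite -[X in measurable X]setTI; apply: mf => //.
exact: measurable_ball.
Qed.

Lemma measurable_mx_boxes : @measurable _ BM = <<s mx_boxes >>.
Proof.
apply/seteqP; split; last first.
  apply: smallest_sub; first exact: sigma_algebra_measurable.
  by move=> _ [B mB <-]; exact: measurable_mx_box.
apply: smallest_sub; first exact: smallest_sigma_algebra.
move=> U oU; rewrite (open_mx_bigcup oU) bigcup_mkcond.
apply: (@countable_bigcupT_measurable _ (g_sigma_algebraType mx_boxes)) => [|[q k]].
  exact: countableP.
case: ifPn => _; last exact: measurable0.
apply: sub_sigma_algebra; exists (fun a i => ball (ratr (q a i) : R) (k.+1%:R^-1)) => //.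
by move=> a i; exact: measurable_ball.
Qed.

Lemma mx_boxes_setI : setI_closed mx_boxes.
Proof.
move=> _ _ [B mB <-] [C mC <-]; exists (fun a i => B a i `&` C a i).
  by move=> a i; exact: measurableI.
apply/seteqP; split => x /=; first by move=> H; split=> a i; case: (H a i).
by move=> [H1 H2] a i; split; [exact: H1|exact: H2].
Qed.

(** Boxes are a generating family closed under intersection, so finite measures are determined by
    them; this lets independence, a statement on boxes, determine the law of the matrix. *)
Lemma borel_mx_measure_unique (m1 m2 : {measure set BM -> \bar R}) :
  (m1 [set: BM] < +oo)%E ->
  (forall B : 'I_n -> 'I_p -> set R, (forall a i, measurable (B a i)) ->
    m1 (mx_box B) = m2 (mx_box B)) ->
  forall A, measurable A -> m1 A = m2 A.
Proof.
move=> m1T m12 A mA.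
refine (@measure_unique _ R BM mx_boxes (fun=> setT) measurable_mx_boxes
  mx_boxes_setI _ _ m1 m2 _ _ A mA).
- by move=> _; exists (fun _ _ => setT) => //; apply/seteqP; split.
- by rewrite bigcup_const //; exists 0%N.
- by move=> _ [B mB <-]; exact: m12.
- by [].
Qed.

End borel_matrices.

(** * Resampling a single entry *)

Section resampling.
Context {R : realType} {n p : nat} {d : measure_display} {T : measurableType d}.
Variables (P : probability T R) (M : 'M[R]_(n, p)).
Variable X : 'I_n -> 'I_p -> {RV P >-> R}.
Hypothesis X_normal : independent_normal M X.
Notation BM := (borel_mx R n p).
Let Xm : T -> BM := random_mx X.

Definition mx_upd (a : 'I_n) (i : 'I_p) (u : R) (x : 'M[R]_(n, p)) : 'M[R]_(n, p) :=
  \matrix_(b, k) if (b == a) && (k == i) then u else x b k.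

Lemma mx_updE a i u x : mx_upd a i u x = x + (u - x a i) *: delta_mx a i.
Proof.
apply/matrixP => b k; rewrite !mxE; case: ifPn => [/andP[/eqP -> /eqP ->]|_].
  by rewrite mulr1 subrKC.
by rewrite mulr0 addr0.
Qed.

Lemma measurable_random_mx : measurable_fun [set: T] Xm.
Proof.
apply: measurable_to_mx => a i; rewrite /Xm.
have -> : (fun w => random_mx X w a i) = X a i by apply/funext => w; rewrite mxE.
exact: measurable_funPT.
Qed.

Lemma measurable_mx_upd_random (a : 'I_n) (i : 'I_p) :
  measurable_fun [set: T * measurableTypeR R]
    (fun z : T * measurableTypeR R => mx_upd a i z.2 (Xm z.1) : BM).
Proof.
apply: measurable_to_mx => b k.
have [/andP[ba ki]|bk] := boolP ((b == a) && (k == i)).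
  have -> : (fun z : T * measurableTypeR R => mx_upd a i z.2 (Xm z.1) b k) = snd.
    by apply/funext => z; rewrite mxE ba ki.
  exact: measurable_snd.
have -> : (fun z : T * measurableTypeR R => mx_upd a i z.2 (Xm z.1) b k) =
    X b k \o fst.
  by apply/funext => z; rewrite mxE (negPf bk) mxE.
exact: measurableT_comp.
Qed.

Lemma measurable_preimage_random_mx (A : set BM) :
  measurable A -> measurable (Xm @^-1` A).
Proof.
by move=> mA; rewrite -[X in measurable X]setTI; exact: measurable_random_mx.
Qed.

Lemma random_mx_box (B : 'I_n -> 'I_p -> set R) :
  (forall a i, measurable (B a i)) ->
  P (Xm @^-1` mx_box B) = (\prod_(ai : 'I_n * 'I_p) P (X ai.1 ai.2 @^-1` B ai.1 ai.2))%E.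
Proof.
move=> mB; have [indep _] := X_normal.
have := indep [set: 'I_n * 'I_p]%SET (fun ai => B ai.1 ai.2) (fun ai => mB ai.1 ai.2).
rewrite (eq_bigl xpredT); last by move=> ai; rewrite finset.in_setT.
move=> <-; congr (P _); apply/seteqP; split => w /= Bw.
  by move=> [a i] _ /=; have := Bw a i; rewrite mxE.
by move=> a i; rewrite mxE; apply: (Bw (a, i)); exact: finset.in_setT.
Qed.

Let N (a : 'I_n) (i : 'I_p) : probability (measurableTypeR R) R :=
  normal_prob (M a i) 1.

(** On a box both sides factor over the entries, and the fresh variable has the same normal law as
    the entry it replaces. *)
Lemma resample_measure (a : 'I_n) (i : 'I_p) (A : set BM) : measurable A ->
  (P \x N a i)%E [set z | A (mx_upd a i z.2 (Xm z.1))] = P (Xm @^-1` A).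
Proof.
move=> mA; have [indep distr] := X_normal.
have mU := measurable_mx_upd_random a i; have mX := measurable_random_mx.
pose U (z : T * measurableTypeR R) : BM := mx_upd a i z.2 (Xm z.1).
have -> : [set z | A (mx_upd a i z.2 (Xm z.1))] = U @^-1` A by [].
apply: (borel_mx_measure_unique (m1 := pushforward (P \x N a i)%E U)
  (m2 := pushforward P Xm)) mA.
  suff : ((P \x N a i)%E [set: T * measurableTypeR R] < +oo)%E by [].
  by rewrite probability_setT ltry.
move=> B mB.
suff : (P \x N a i)%E (U @^-1` mx_box B) = P (Xm @^-1` mx_box B) by [].
rewrite random_mx_box // (bigD1 (a, i)) //=.
have -> : P (X a i @^-1` B a i) = N a i (B a i) by exact: distr.
have -> : U @^-1` mx_box B =
    (\bigcap_(bk in [set` [set~ (a, i)]%SET]) X bk.1 bk.2 @^-1` B bk.1 bk.2)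
      `*` B a i.
  apply/seteqP; split => [[w u] /= Bw|[w u] /= [Bw Bu] b k].
    split; last by have := Bw a i; rewrite mxE !eqxx.
    move=> [b k] /=; rewrite !inE => bk; have := Bw b k.
    by rewrite mxE -xpair_eqE (negPf bk) mxE.
  rewrite mxE; case: ifPn => [/andP[/eqP -> /eqP ->] //|bk].
  by rewrite mxE; apply: (Bw (b, k)); rewrite /= !inE xpair_eqE.
have mcap : measurable (\bigcap_(bk in [set` [set~ (a, i)]%SET])
    (X bk.1 bk.2 @^-1` B bk.1 bk.2)).
  apply: fin_bigcap_measurable; first exact: finite_finset.
  move=> bk _; rewrite -[X in measurable X]setTI; exact: measurable_funPT.
rewrite product_measure1E //; last exact: mB.
rewrite muleC; congr (_ * _)%E.
apply: etrans (indep [set~ (a, i)]%SET (fun bk => B bk.1 bk.2) _) _ => //.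
by apply: eq_bigl => bk; rewrite !inE.
Qed.

Let nu a i : probability (T * measurableTypeR R)%type R := (P \x N a i)%E.

(** The measure of [A] is the integral of the nonnegative measures of its traces on the coordinate
    lines; if it is 0, almost all traces are null. *)
Lemma resample_ae (a : 'I_n) (i : 'I_p) (A : set BM) : measurable A ->
  P (Xm @^-1` A) = 0%E ->
  {ae P, forall w, N a i [set u | A (mx_upd a i u (Xm w))] = 0%E}.
Proof.
move=> mA; rewrite -(resample_measure a i mA) /= /product_measure1.
have mU := measurable_mx_upd_random a i.
set B := [set z | _].
have mB : measurable B by rewrite -[B]setTI; exact: mU.
pose f := (fun A0 => N a i \o xsection A0) B.
have mf : measurable_fun [set: T] f by exact: measurable_fun_xsection.
move=> int0.
have : (\int[P]_w `|f w| = 0)%E.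
  by rewrite -[RHS]int0; apply: eq_integral => w _; rewrite gee0_abs.
move/(ae_eq_integral_abs P measurableT mf); apply: filterS => w /(_ I) /=.
rewrite /f /= => <-; congr (normal_prob _ _ _).
by apply/seteqP; split => u /=; rewrite /xsection /= inE.
Qed.

Lemma resample_integral (a : 'I_n) (i : 'I_p) (F : 'M[R]_(n, p) -> R) :
  measurable_fun [set: BM] (F : BM -> R) ->
  P.-integrable [set: T] (fun w => (F (Xm w))%:E) ->
  (P \x N a i)%E.-integrable setT (fun z => (F (mx_upd a i z.2 (Xm z.1)))%:E) /\
  (\int[P]_w (F (Xm w))%:E = \int[P]_w \int[N a i]_u (F (mx_upd a i u (Xm w)))%:E)%E.
Proof.
move=> mF iF.
have mU := measurable_mx_upd_random a i; have mX := measurable_random_mx.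
pose U (z : T * measurableTypeR R) : BM := mx_upd a i z.2 (Xm z.1).
pose m1 : {measure set BM -> \bar R} := pushforward (P \x N a i)%E U.
pose m2 : {measure set BM -> \bar R} := pushforward P Xm.
have mE : measurable_fun [set: BM] (fun x => (F x)%:E) by exact/measurable_EFinP.
have m12 A : measurable A -> m1 mU A = m2 mX A by exact: resample_measure.
have iU : (P \x N a i)%E.-integrable setT (fun z => (F (U z))%:E).
  apply/integrableP; split; first exact: measurableT_comp mE mU.
  have mA : measurable_fun [set: BM] (fun x => `|(F x)%:E|)%E.
    exact: measurableT_comp.
  have := @ge0_integral_pushforward _ _ _ _ R U mU (P \x N a i)%E setT _ measurableT mA.
  rewrite preimage_setT /= => <-; last by move=> x _.
  rewrite -[X in (X < _)%E]/(\int[m1 mU]_x `|(F x)%:E|)%E.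
  rewrite (eq_measure_integral (m2 mX)); last by move=> A mA' _; exact: m12.
  rewrite (@ge0_integral_pushforward _ _ _ _ R Xm mX P setT _ measurableT mA) //.
  by case/integrableP : iF.
split=> //.
rewrite (integral12_prod_meas1 iU).
have <- := @integral_pushforward _ _ _ _ R Xm mX P setT _ mE iF measurableT.
have := @integral_pushforward _ _ _ _ R U mU (P \x N a i)%E setT _ mE iU measurableT.
rewrite preimage_setT => <-.
by apply: (eq_measure_integral (m1 mU)) => A mA _; rewrite -[LHS]/(m2 mX A) -m12.
Qed.

End resampling.

(** * Zero sets of polynomials in the entries *)

Section polynomial_null_sets.
Context {R : realType}.

Lemma finite_set_roots (q : {poly R}) : q != 0 -> finite_set [set u | q.[u] = 0].
Proof.
have [m] := ubnP (size q); elim: m q => // m IH q sq q0.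
have [[a qa]|nr] := pselect (exists a, q.[a] = 0); last first.
  rewrite (_ : [set u | _] = set0) //.
  by apply/seteqP; split => u //= qu; apply: nr; exists u.
have /factor_theorem[r qE] : root q a by apply/eqP.
have r0 : r != 0 by apply: contraNneq q0 => r0; rewrite qE r0 mul0r.
have sr : (size r < m)%N.
  by move: sq; rewrite qE size_Mmonic ?monicXsubC // size_XsubC addn2 ltnS.
apply: (@sub_finite_set _ _ ([set u | r.[u] = 0] `|` [set a])).
  move=> u /=; rewrite qE hornerM hornerXsubC => /eqP.
  by rewrite mulf_eq0 subr_eq0 => /orP[] /eqP; [left|right].
by rewrite finite_setU; split; [exact: IH|exact: finite_set1].
Qed.

Lemma normal_prob_finite (m s : R) (A : set R) : finite_set A -> normal_prob m s A = 0%E.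
Proof.
move=> fA; apply/eqP.
have mA : measurable (A : set (measurableTypeR R)).
  apply: countable_measurable => //; exact: finite_set_countable.
have lA : lebesgue_measure A = 0%E.
  by apply: countable_lebesgue_measure0; exact: finite_set_countable.
have /null_content_dominatesP D := normal_prob_dominates m s.
by apply/eqP; apply: D.
Qed.

Context {n p : nat} {d : measure_display} {T : measurableType d}.
Variables (P : probability T R) (M : 'M[R]_(n, p)).
Variable X : 'I_n -> 'I_p -> {RV P >-> R}.
Hypothesis X_normal : independent_normal M X.
Notation BM := (borel_mx R n p).

Lemma separately_poly_neq0_ae (F : 'M[R]_(n, p) -> R) (x0 : 'M[R]_(n, p)) :
  measurable_fun [set: BM] (F : BM -> R) ->
  (forall x v, exists q : {poly R}, forall u, F (x + u *: v) = q.[u]) ->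
  F x0 != 0 ->
  {ae P, forall w, F (random_mx X w) != 0}.
Proof.
move=> mF polyF Fx0.
(* The entries of [x0] are replaced by random ones one at a time; at each step
   a nonzero polynomial in one variable has finitely many roots. *)
pose hyb (S : seq ('I_n * 'I_p)) (x : 'M[R]_(n, p)) : 'M[R]_(n, p) :=
  \matrix_(a, i) if (a, i) \in S then x a i else x0 a i.
have mhyb S : measurable_fun [set: BM] (fun x : BM => F (hyb S x)).
  apply: (measurableT_comp mF); apply: measurable_to_mx => a i.
  have [aS|aS] := boolP ((a, i) \in S).
    have -> : (fun w : BM => hyb S w a i) = (fun w : BM => w a i).
      by apply/funext => w; rewrite mxE aS.
    exact: measurable_entry.
  have -> : (fun w : BM => hyb S w a i) = cst (x0 a i).
    by apply/funext => w; rewrite mxE (negPf aS).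
  exact: measurable_cst.
have key S : {ae P, forall w, F (hyb S (random_mx X w)) != 0}.
  elim: S => [|[a i] S IH].
    apply: aeW => w; suff -> : hyb [::] (random_mx X w) = x0 by [].
    by apply/matrixP => a i; rewrite mxE in_nil.
  have [aS|aS] := boolP ((a, i) \in S).
    have -> : hyb ((a, i) :: S) = hyb S => //.
    apply/funext => x; apply/matrixP => b k; rewrite !mxE inE.
    by case: eqP => [->|//]; rewrite aS.
  pose A : set BM := [set x | F (hyb ((a, i) :: S) x) = 0].
  have mA : measurable A.
    rewrite (_ : A = (fun x : BM => F (hyb ((a, i) :: S) x)) @^-1` [set 0]) //.
    by rewrite -[X in measurable X]setTI; apply: mhyb => //; exact: measurable_set1.
  suff PA : P ((random_mx X : T -> BM) @^-1` A) = 0%E.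
    exists ((random_mx X : T -> BM) @^-1` A); split=> //.
      exact: (measurable_preimage_random_mx X mA).
    by move=> w /= /negP; rewrite negbK => /eqP.
  rewrite -(resample_measure X_normal a i mA) /= /product_measure1.
  have mU := measurable_mx_upd_random X a i.
  set B := [set z | _].
  have mB : measurable B by rewrite -[B]setTI; exact: mU.
  rewrite -[RHS](integral0 P setT); apply: ae_eq_integral => //.
    exact: measurable_fun_xsection.
  move: IH; apply: filterS => w Fw _ /=.
  apply: normal_prob_finite.
  pose y := hyb S (random_mx X w).
  have ya : y a i = x0 a i by rewrite mxE (negPf aS).
  (* The base point has entry 0 at [(a, i)], so the parameter of the line is that entry itself. At
     [y a i] the polynomial takes the value [F y], nonzero by induction. *)
  have [q qE] := polyF (y - y a i *: delta_mx a i) (delta_mx a i).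
  have hE u : hyb ((a, i) :: S) (mx_upd a i u (random_mx X w)) =
      y - y a i *: delta_mx a i + u *: delta_mx a i.
    have -> : y - y a i *: delta_mx a i + u *: delta_mx a i = mx_upd a i u y.
      by rewrite mx_updE scalerBl addrAC addrA.
    apply/matrixP => b k; rewrite !mxE inE xpair_eqE; case: ifPn => [/orP[]|].
    - by move=> ->.
    - move=> bS; rewrite bS; case: ifPn => //.
    - by rewrite negb_or => /andP[/negPf -> /negPf ->].
  have q0 : q != 0.
    apply: contra_neq Fw => q0.
    by rewrite -/y -[y](subrK (y a i *: delta_mx a i)) qE q0 horner0.
  apply: sub_finite_set (finite_set_roots q0) => u.
  by rewrite /xsection /= inE /B /A /= hE qE.
have := key (enum {: 'I_n * 'I_p}); apply: filterS => w.
congr (F _ != 0); apply/matrixP => a i; by rewrite mxE mem_enum.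
Qed.

Lemma measurable_gram_disc : measurable_fun [set: BM] (fun x : BM => gram_disc (x : 'M[R]_(n, p))).
Proof.
have mM (k l m : nat) (A : BM -> 'M[R]_(k, l)) (B : BM -> 'M[R]_(l, m)) :
    (forall i j, measurable_fun setT (fun x => A x i j)) ->
    (forall i j, measurable_fun setT (fun x => B x i j)) ->
    forall i j, measurable_fun setT (fun x => (A x *m B x) i j).
  move=> mA mB i j; under eq_fun do rewrite mxE.
  by apply: measurable_sum => c; exact: measurable_funM.
have mG i j : measurable_fun setT (fun x : BM => ((x : 'M[R]_(n, p))^T *m x) i j).
  apply: mM => a b; last exact: measurable_entry.
  by under eq_fun do rewrite mxE; exact: measurable_entry.
have mI m i j : measurable_fun setT (fun x : BM =>
    (iter m (mulmx ((x : 'M[R]_(n, p))^T *m x)) ((x : 'M[R]_(n, p))^T *m x)) i j).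
  by elim: m i j => [|m IH] i j //=; exact: mM.
apply: measurable_sum => s; apply: measurable_funM => //.
apply: measurable_prod => i _; under eq_fun do rewrite mxE.
by apply: measurable_sum => c; exact: mI.
Qed.

Lemma gram_disc_neq0_ae : {ae P, forall w, gram_disc (random_mx X w) != 0}.
Proof.
have [x0 x00] := @gram_disc_witness R n p.
apply: separately_poly_neq0_ae x00; first exact: measurable_gram_disc.
exact: gram_disc_line.
Qed.

End polynomial_null_sets.

(** * Stein's identity *)

Section density.
Context {d : measure_display} {T : measurableType d} {R : realType}.
Variables (mu nu : {measure set T -> \bar R}) (phi : T -> R).
Hypothesis phi_ge0 : forall x, 0 <= phi x.
Hypothesis mphi : measurable_fun [set: T] phi.
Hypothesis nuE : forall A, measurable A -> nu A = (\int[mu]_(x in A) (phi x)%:E)%E.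

Import HBNNSimple.
Local Open Scope ereal_scope.

(** First stage of the usual ascent to a change of density: simple functions, then monotone limits,
    then positive and negative parts. *)
Lemma integral_density_nnsfun (g : {nnsfun T >-> R}) :
  \int[nu]_x (g x)%:E = \int[mu]_x ((g x)%:E * (phi x)%:E).
Proof.
under [LHS]eq_integral do rewrite fimfunE -fsumEFin//.
rewrite ge0_integral_fsum//; last 2 first.
- by move=> r; exact/measurable_EFinP/measurableT_comp.
- by move=> r x _; rewrite EFinM nnfun_muleindic_ge0.
under [RHS]eq_integral.
  move=> x xD; rewrite fimfunE -fsumEFin// muleC ge0_mule_fsumr; last first.
    by move=> r; rewrite EFinM nnfun_muleindic_ge0.
  over.
rewrite [RHS]ge0_integral_fsum//; last 2 first.
- move=> r; apply: emeasurable_funM; apply/measurable_EFinP => //.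
  exact/measurableT_comp.
- move=> r x _; apply: mule_ge0; first by rewrite lee_fin.
  by rewrite EFinM nnfun_muleindic_ge0.
apply: eq_fsbigr => r _.
have mr : measurable (g @^-1` [set r]) by exact: measurable_sfunP.
have [r0|r0] := leP 0%R r; last first.
  rewrite preimage_nnfun0 // indic0; rewrite !integral0_eq // => x _.
    by rewrite mulr0 mule0.
  by rewrite mulr0.
rewrite integralZl_indic_nnsfun // integral_indic // setIT nuE //.
under [RHS]eq_integral => x _ do rewrite EFinM muleCA.
rewrite ge0_integralZl //; last 2 first.
- by apply: emeasurable_funM; apply/measurable_EFinP.
- by move=> x _; rewrite mule_ge0 // lee_fin.
congr (_ * _); rewrite integral_mkcond; apply: eq_integral => x _.
by rewrite patchE indicE; case: ifPn => _; rewrite ?mule1 ?mule0.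
Qed.

Lemma ge0_integral_density (f : T -> \bar R) :
  measurable_fun [set: T] f -> (forall x, 0 <= f x) ->
  \int[nu]_x f x = \int[mu]_x (f x * (phi x)%:E).
Proof.
move=> mf f0; pose f_ := nnsfun_approx measurableT mf.
have f_cvg x : EFin \o f_ ^~ x @ \oo --> f x.
  by apply: cvg_nnsfun_approx => //; exact: f0.
transitivity (limn (fun k => \int[nu]_x (f_ k x)%:E)).
  rewrite -monotone_convergence//=.
  - by apply: eq_integral => x _; apply/esym/cvg_lim => //; exact: f_cvg.
  - by move=> k; exact/measurable_EFinP/measurable_funTS.
  - by move=> k x _; rewrite lee_fin.
  - by move=> x _ a b ab; rewrite lee_fin; exact/lefP/nd_nnsfun_approx.
transitivity (limn (fun k => \int[mu]_x ((f_ k x)%:E * (phi x)%:E))).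
  by congr (limn _); apply/funext => k; exact: integral_density_nnsfun.
rewrite -monotone_convergence//=.
- apply: eq_integral => x _; apply/cvg_lim => //.
  by apply: cvgeZr => //; exact: f_cvg.
- by move=> k; apply: emeasurable_funM; apply/measurable_EFinP => //; exact/measurable_funTS.
- by move=> k x _; rewrite mule_ge0 // lee_fin.
- move=> x _ a b ab; rewrite lee_wpmul2r ?lee_fin //.
  exact/lefP/nd_nnsfun_approx.
Qed.

Lemma integrable_density (f : T -> R) : measurable_fun [set: T] f ->
  nu.-integrable setT (EFin \o f) <-> mu.-integrable setT (fun x => (f x * phi x)%:E).
Proof.
move=> mf; have E : \int[nu]_x `|(f x)%:E| = \int[mu]_x `|(f x * phi x)%:E|.
  rewrite ge0_integral_density //; last exact/measurableT_comp/measurable_EFinP.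
  by apply: eq_integral => x _; rewrite EFinM abseM [`|(phi x)%:E|]gee0_abs // lee_fin.
split=> /integrableP[_ lty]; apply/integrableP; split.
- by apply/measurable_EFinP/measurable_funM.
- by rewrite -E.
- exact/measurable_EFinP.
- by rewrite E.
Qed.

Lemma integral_density (f : T -> R) : measurable_fun [set: T] f ->
  \int[nu]_x (f x)%:E = \int[mu]_x (f x * phi x)%:E.
Proof.
move=> mf; rewrite [LHS]integralE [RHS]integralE.
have mE : measurable_fun [set: T] (EFin \o f) by exact/measurable_EFinP.
rewrite !ge0_integral_density //; last 2 first.
- exact: measurable_funeneg.
- exact: measurable_funepos.
congr (_ - _); apply: eq_integral => x _.
- rewrite !funeposE -[0]/(0%:E) -!EFin_max -EFinM; congr (_%:E).
  by rewrite maxr_pMl // mul0r.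
- rewrite !funenegE -!EFinN -[0]/(0%:E) -!EFin_max -EFinM; congr (_%:E).
  by rewrite maxr_pMl // mul0r mulNr.
Qed.

End density.

(** * Stein's identity for one normal variable *)

Section stein_identity.
Context {R : realType}.
Notation leb := (@lebesgue_measure R).

Lemma normal_pdf1E (m x : R) :
  normal_pdf m 1 x = normal_peak 1 * expR (- (x - m) ^+ 2 / 2).
Proof. by rewrite normal_pdfE ?oner_neq0 // /normal_fun expr1n. Qed.

Lemma is_derive_normal_pdf (m x : R) :
  is_derive x (1 : R) (normal_pdf m 1) (- (x - m) * normal_pdf m 1 x).
Proof.
have -> : normal_pdf m 1 = (fun x => normal_peak 1 * expR (- (x - m) ^+ 2 / 2)).
  by apply/funext => y; rewrite normal_pdf1E.
have dq : is_derive x (1 : R) (fun x : R => - (x - m) ^+ 2 / 2) (- (x - m)).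
  apply: is_derive_eq; rewrite /GRing.scale /=. by field.
have dE := @is_derive1_comp R expR (fun x : R => - (x - m) ^+ 2 / 2) x _ _ (is_derive_expR _) dq.
 apply: is_derive_eq; rewrite /GRing.scale /=; ring.
Qed.

Lemma cvg_normal_pdf (m : R) : normal_pdf m 1 x @[x --> +oo] --> (0 : R).
Proof.
(* The bound rests on [x - (m + 2) <= (x - m) ^+ 2 / 2], which trades the Gaussian for a plain
   exponential. *)
apply: (@squeeze_cvgr _ _ _ _ (fun=> 0) (fun x => normal_peak 1 * expR (- (x - (m + 2))))).
- near=> x; rewrite normal_pdf_ge0 /= normal_pdf1E ler_wpM2l ?normal_peak_ge0 //.
  rewrite ler_expR mulNr lerN2.
  have : m + 2 <= x by near: x; apply: nbhs_pinfty_ge; exact: num_real.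
  move=> mx; rewrite ler_pdivlMr //; nra.
- exact: cvg_cst.
- rewrite -(mulr0 (normal_peak 1)); apply: cvgM; first exact: cvg_cst.
  by rewrite (cvg_centerr (m + 2) (fun x => expR (- x))); exact: cvgr_expR.
Unshelve. all: by end_near. Qed.

Lemma normal_pdf_opp (m x : R) : normal_pdf m 1 (- x) = normal_pdf (- m) 1 x.
Proof. by rewrite !normal_pdf1E; congr (_ * expR _); ring. Qed.

(** The integrand is the derivative of minus the density, and the density vanishes at infinity. *)
Lemma integral_normal_tail (m a : R) : m <= a ->
  (\int[leb]_(z in `[a, +oo[) ((z - m) * normal_pdf m 1 z)%:E = (normal_pdf m 1 a)%:E)%E.
Proof.
move=> ma.
have cpdf : continuous (normal_pdf m 1) by apply: continuous_normal_pdf; exact: oner_neq0.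
have dN x : is_derive x (1 : R) (fun z => - normal_pdf m 1 z) ((x - m) * normal_pdf m 1 x).
  have := is_derive_normal_pdf m x => dx.
  by apply: is_derive_eq; rewrite mulNr opprK.
rewrite (@ge0_continuous_FTC2y R _ (fun z => - normal_pdf m 1 z) a 0).
- by rewrite -EFinN opprK add0e.
- by move=> x ax; rewrite mulr_ge0 ?normal_pdf_ge0 // subr_ge0 (le_trans ma).
- apply: continuous_subspaceT => x; apply: cvgM; last exact: cpdf.
  by apply: cvgB; [exact: cvg_id|exact: cvg_cst].
- by rewrite -oppr0; apply: cvgN; exact: cvg_normal_pdf.
- by move=> x _; case: (dN x).
- by apply: cvg_at_right_filter; apply: cvgN; exact: cpdf.
- by move=> x _; rewrite derive1E; case: (dN x).
Qed.

Lemma integral_normal_head (m b : R) : b <= m ->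
  (\int[leb]_(z in `]-oo, b]) ((m - z) * normal_pdf m 1 z)%:E = (normal_pdf m 1 b)%:E)%E.
Proof.
move=> bm.
have cpdf : continuous (normal_pdf m 1) by apply: continuous_normal_pdf; exact: oner_neq0.
rewrite -[b in `]-oo, b]]opprK ge0_integration_by_substitutionNy.
- rewrite -[in RHS](opprK b) normal_pdf_opp -(@integral_normal_tail (- m) (- b)) ?lerN2 //.
  apply: eq_integral => z _ /=; rewrite normal_pdf_opp; congr (_ * _)%:E.
  by rewrite !opprK addrC.
- apply: continuous_subspaceT => x; apply: cvgM; last exact: cpdf.
  by apply: cvgB; [exact: cvg_cst|exact: cvg_id].
- move=> x; rewrite in_itv /= opprK => xb; rewrite mulr_ge0 ?normal_pdf_ge0 // subr_ge0.
  by rewrite (le_trans (ltW xb)).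
Qed.

Lemma measurable_set_ler d (T : measurableType d) (f g : T -> R) :
  measurable_fun [set: T] f -> measurable_fun [set: T] g ->
  measurable [set x | f x <= g x].
Proof.
move=> mf mg; rewrite (_ : [set x | _] = (fun x => g x - f x) @^-1` `[0, +oo[%classic).
  rewrite -[X in measurable X]setTI; apply: (measurable_funB mg mf) => //.
by apply/seteqP; split => x /=; rewrite in_itv /= andbT subr_ge0.
Qed.

(** The pairs [(z, u)] with [u] between [m] and [z]. The value [u = m] is given to the upper piece
    only, which keeps the two pieces disjoint. *)
Let btw (m : R) : set (measurableTypeR R * measurableTypeR R) :=
  ([set zu | m <= zu.2] `&` [set zu | zu.2 <= zu.1]) `|`
  ([set zu | zu.1 <= zu.2] `\` [set zu | m <= zu.2]).

Let measurable_btw m : measurable (btw m).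
Proof.
have m1 : measurable_fun setT (fst : measurableTypeR R * measurableTypeR R -> R).
  exact: measurable_fst.
have m2 : measurable_fun setT (snd : measurableTypeR R * measurableTypeR R -> R).
  exact: measurable_snd.
by apply: measurableU; [apply: measurableI|apply: measurableD];
  apply: measurable_set_ler.
Qed.

Let kern (m : R) (zu : measurableTypeR R * measurableTypeR R) : R :=
  `|zu.1 - m| * normal_pdf m 1 zu.1 * \1_(btw m) zu.

Let kern_ge0 m zu : 0 <= kern m zu.
Proof. by rewrite /kern !mulr_ge0 ?normal_pdf_ge0. Qed.

Let measurable_kern m : measurable_fun setT (kern m).
Proof.
apply: measurable_funM; last exact: measurable_indic.
have m1 : measurable_fun setT (fst : measurableTypeR R * measurableTypeR R -> R).
  exact: measurable_fst.
apply: measurable_funM.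
  by apply: measurableT_comp => //; apply: measurable_funB.
exact: (measurableT_comp (measurable_normal_pdf m 1) m1).
Qed.

(* [kern m] is the Peano kernel of the identity: integrating out the first
   variable returns the density, integrating out the second one returns the
   increment of a primitive. *)
Let integral_kern_fst m u : (\int[leb]_z (kern m (z, u))%:E = (normal_pdf m 1 u)%:E)%E.
Proof.
have [mu|um] := leP m u.
  rewrite -(integral_normal_tail mu) [RHS]integral_mkcond; apply: eq_integral => z _.
  rewrite patchE /kern /= mem_setE in_itv /= andbT indicE /btw.
  case: ifPn => uz.
    rewrite mem_set; last by left.
    by rewrite mulr1 ger0_norm // subr_ge0 (le_trans mu).
  rewrite memNset ?mulr0 //= => -[[_ zu]|[_]]; first by rewrite zu in uz.
  by move=> /(_ mu).
rewrite -(integral_normal_head (ltW um)) [RHS]integral_mkcond; apply: eq_integral => z _.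
rewrite patchE /kern /= mem_setE in_itv /= indicE /btw.
case: ifPn => zu.
  rewrite mem_set; last by right; split=> //=; apply/negP; rewrite -ltNge.
  by rewrite mulr1 distrC ger0_norm // subr_ge0 (le_trans zu) // ltW.
rewrite memNset ?mulr0 //= => -[[mu _]|[zu' _]].
  by move: um; rewrite ltNge mu.
by rewrite zu' in zu.
Qed.

Section primitive.
Variables (m : R) (f f' : R -> R).
Hypothesis ac : forall s t : R, s <= t ->
  leb.-integrable `[s, t] (fun u => (f' u)%:E) /\
  f t - f s = \int[leb]_(u in `[s, t]) f' u.
Hypothesis f'_int : (normal_prob m 1).-integrable setT (EFin \o f').

Let acE s t : s <= t -> (\int[leb]_(u in `[s, t]) (f' u)%:E = (f t - f s)%:E)%E.
Proof.
by move=> st; have [ist ->] := ac st; rewrite /Rintegral fineK // integrable_fin_num.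
Qed.

Let mf' : measurable_fun [set: R] f'.
Proof. by apply/measurable_EFinP; case/integrableP : f'_int. Qed.

Let integral_kern_snd z :
  (\int[leb]_u (f' u * kern m (z, u))%:E = ((z - m) * (f z - f m) * normal_pdf m 1 z)%:E)%E.
Proof.
have mfI (D : set R) : measurable_fun D (fun u => (f' u)%:E).
  by apply/measurable_EFinP/measurable_funTS.
have [mz|zm] := leP m z.
  rewrite mulrAC EFinM -acE // -integralZl //; last by have [] := ac mz.
  rewrite [RHS]integral_mkcond; apply: eq_integral => u _.
  rewrite patchE /kern /= mem_setE in_itv /= indicE /btw -EFinM.
  case: ifPn => [/andP[mu uz]|uz].
    rewrite mem_set; last by left.
    by rewrite mulr1 ger0_norm ?subr_ge0 // mulrC.
  rewrite memNset ?mulr0 //= => -[[mu uz']|[zu /negP]].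
    by rewrite mu uz' in uz.
  by rewrite -ltNge ltNge (le_trans mz zu).
(* Below [m] both differences change sign, so the nonnegative kernel still yields the right
   product. *)
have -> : (z - m) * (f z - f m) * normal_pdf m 1 z =
    (m - z) * normal_pdf m 1 z * (f m - f z) by ring.
(* On this side [btw] omits [u = m]; dropping an endpoint does not change the integral. *)
rewrite EFinM -acE ?ltW // -integral_itv_bndo_bndc; last exact: mfI.
rewrite -integralZl //; last first.
  have [+ _] := ac (ltW zm); apply: integrableS => //.
  by apply: subset_itvl; rewrite bnd_simp.
rewrite [RHS]integral_mkcond; apply: eq_integral => u _.
rewrite patchE /kern /= mem_setE in_itv /= indicE /btw -EFinM.
case: ifPn => [/andP[zu um]|zum].
  rewrite mem_set; last by right; split=> //=; apply/negP; rewrite -ltNge.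
  by rewrite mulr1 distrC ger0_norm ?subr_ge0 ?ltW // mulrC.
rewrite memNset ?mulr0 //= => -[[mu uz]|[zu /negP]].
  by move: zm; rewrite ltNge (le_trans mu uz).
by rewrite -ltNge => um; rewrite zu um in zum.
Qed.

Let g (zu : measurableTypeR R * measurableTypeR R) : R := f' zu.2 * kern m zu.

Let measurable_g : measurable_fun setT g.
Proof.
apply: measurable_funM; last exact: measurable_kern.
exact: measurableT_comp mf' measurable_snd.
Qed.

Let normal_probE A : measurable A ->
  normal_prob m 1 A = (\int[leb]_(x in A) (normal_pdf m 1 x)%:E)%E.
Proof. by []. Qed.

Let integrable_normal (k : R -> R) : measurable_fun [set: R] k ->
  (normal_prob m 1).-integrable setT (EFin \o k) <->
  leb.-integrable setT (fun x => (k x * normal_pdf m 1 x)%:E).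
Proof.
move=> mk.
refine (@integrable_density _ _ R leb (normal_prob m 1) (normal_pdf m 1)
  (normal_pdf_ge0 m 1) (measurable_normal_pdf m 1) normal_probE k mk).
Qed.

Let integral_normal (k : R -> R) : measurable_fun [set: R] k ->
  (\int[normal_prob m 1]_x (k x)%:E = \int[leb]_x (k x * normal_pdf m 1 x)%:E)%E.
Proof.
move=> mk.
refine (@integral_density _ _ R leb (normal_prob m 1) (normal_pdf m 1)
  (normal_pdf_ge0 m 1) (measurable_normal_pdf m 1) normal_probE k mk).
Qed.

(** By Tonelli it is enough to integrate out [z] first, which leaves the absolute value of [f']
    times the density. The integrability of [f'] thus yields that of [(z - m) * f z] as a
    conclusion. *)
Let integrable_g : (leb \x leb)%E.-integrable setT (EFin \o g).
Proof.
apply/integrable21ltyP; first exact/measurable_EFinP.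
have E u : (\int[leb]_z `|(EFin \o g) (z, u)| = `|(f' u * normal_pdf m 1 u)%:E|)%E.
  rewrite EFinM abseM [`|(normal_pdf m 1 u)%:E|%E]gee0_abs ?lee_fin ?normal_pdf_ge0 //.
  rewrite -integral_kern_fst -ge0_integralZl //.
  - by apply: eq_integral => z _; rewrite /g /= normrM [`|kern _ _|]ger0_norm.
  - apply/measurable_EFinP; exact: (measurable_fun_pair1 u (@measurable_kern m)).
  - by move=> z _; rewrite lee_fin.
under eq_integral do rewrite E.
by case/integrableP : ((integrable_normal mf').1 f'_int).
Qed.

Let h z := (z - m) * (f z - f m).

Let FE z : fubini_F leb (EFin \o g) z = (h z * normal_pdf m 1 z)%:E.
Proof. by rewrite /fubini_F /g /= integral_kern_snd. Qed.

Let measurable_hpdf : measurable_fun [set: R] (fun z => h z * normal_pdf m 1 z).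
Proof.
apply/measurable_EFinP; rewrite (_ : EFin \o _ = fubini_F leb (EFin \o g)).
  exact: measurable_fubini_F integrable_g.
by apply/funext => z; rewrite FE.
Qed.

(** Fubini's theorem makes the product of [h] with the density measurable, and the density is
    positive, so it can be divided out. *)
Let mh : measurable_fun [set: R] h.
Proof.
have peak0 : normal_peak 1 != 0 :> R by rewrite gt_eqF // normal_peak_gt0 ?oner_neq0.
have -> : h = fun z => (h z * normal_pdf m 1 z) *
    ((normal_peak 1)^-1 * expR (- (- (z - m) ^+ 2 / 2))).
  apply/funext => z; rewrite normal_pdf1E expRN.
  have e0 : expR (- (z - m) ^+ 2 / 2) != 0 by rewrite gt_eqF // expR_gt0.
  by field; rewrite e0 peak0.
apply: measurable_funM => //; apply: measurable_funM => //.
apply: measurableT_comp; first exact: measurable_expR.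
apply: measurable_funN; apply: measurable_funM => //.
by apply: measurable_funN; apply: measurable_funX; apply: measurable_funB.
Qed.

Let integrable_h : (normal_prob m 1).-integrable setT (EFin \o h).
Proof.
apply/(integrable_normal mh).
by apply: eq_integrable (integrable_fubini_F integrable_g) => // z _; rewrite FE.
Qed.

Let integral_h :
  (\int[normal_prob m 1]_z (h z)%:E = \int[normal_prob m 1]_u (f' u)%:E)%E.
Proof.
rewrite (integral_normal mh) (integral_normal mf').
transitivity (\int[leb]_z fubini_F leb (EFin \o g) z)%E.
  by apply: eq_integral => z _; rewrite FE.
rewrite (integral12_prod_meas1 integrable_g) -(integral21_prod_meas1 integrable_g).
apply: eq_integral => u _; rewrite /fubini_G /g /=.
rewrite EFinM -integral_kern_fst -integralZl //.
apply/integrableP; split.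
  apply/measurable_EFinP; exact: (measurable_fun_pair1 u (@measurable_kern m)).
under eq_integral do rewrite gee0_abs ?lee_fin //.
by rewrite integral_kern_fst ltry.
Qed.

(** Positive and negative parts are the two half-line integrals from [m]; both equal the density at
    [m], so they are finite and cancel. *)
Lemma integrable_normal_center :
  (normal_prob m 1).-integrable setT (fun z => (z - m)%:E) /\
  (\int[normal_prob m 1]_z (z - m)%:E = 0)%E.
Proof.
have mc : measurable_fun [set: R] (fun z : R => z - m) by exact: measurable_funB.
have mcp : measurable_fun [set: R] (fun z : R => (z - m) * normal_pdf m 1 z).
  by apply: measurable_funM => //; exact: measurable_normal_pdf.
have mcpE : measurable_fun [set: R] (fun z : R => ((z - m) * normal_pdf m 1 z)%:E).
  exact/measurable_EFinP.
have pos : (\int[leb]_z (fun z => ((z - m) * normal_pdf m 1 z)%:E)^\+ z = (normal_pdf m 1 m)%:E)%E.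
  rewrite -(integral_normal_tail (lexx m)) [RHS]integral_mkcond; apply: eq_integral => z _.
  rewrite patchE mem_setE in_itv /= andbT funeposE -[0]/(0%:E) -EFin_max.
  case: ifPn => mz; congr (_%:E).
    by apply/max_idPl; rewrite mulr_ge0 ?normal_pdf_ge0 // subr_ge0.
  apply/max_idPr; rewrite -ltNge in mz.
  by rewrite mulr_le0_ge0 ?normal_pdf_ge0 // subr_le0 ltW.
have neg : (\int[leb]_z (fun z => ((z - m) * normal_pdf m 1 z)%:E)^\- z = (normal_pdf m 1 m)%:E)%E.
  rewrite -(integral_normal_head (lexx m)) [RHS]integral_mkcond; apply: eq_integral => z _.
  rewrite patchE mem_setE in_itv /= funenegE -EFinN -[0]/(0%:E) -EFin_max.
  rewrite -mulNr opprB; case: ifPn => mz; congr (_%:E).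
    by apply/max_idPl; rewrite mulr_ge0 ?normal_pdf_ge0 // subr_ge0.
  apply/max_idPr; rewrite -ltNge in mz.
  by rewrite mulr_le0_ge0 ?normal_pdf_ge0 // subr_le0 ltW.
split.
  apply/(integrable_normal mc)/integrableP; split=> //.
  rewrite -[X in (\int[_]_x X x)%E]/(abse \o (fun z => ((z - m) * normal_pdf m 1 z)%:E)).
  rewrite fune_abse ge0_integralD //; last 2 first.
  - exact: measurable_funepos.
  - exact: measurable_funeneg.
  by rewrite pos neg -EFinD ltry.
by rewrite (integral_normal mc) integralE pos neg -EFinB subrr.
Qed.

(** Fubini's theorem settles [f - f m]; the constant [f m] contributes a multiple of the centred
    mean, which is 0. *)
Lemma stein_normal :
  (normal_prob m 1).-integrable setT (fun z => ((z - m) * f z)%:E) /\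
  (\int[normal_prob m 1]_z ((z - m) * f z)%:E = \int[normal_prob m 1]_u (f' u)%:E)%E.
Proof.
have [ic c0] := integrable_normal_center.
have E : (fun z => ((z - m) * f z)%:E) =
    (fun z => (h z)%:E + (f m)%:E * (z - m)%:E)%E.
  by apply/funext => z; rewrite -EFinM -EFinD /h; congr (_%:E); ring.
have iZ := integrableZl measurableT (f m) ic.
rewrite E; split; first exact: integrableD.
by rewrite integralD // integralZl // c0 mule0 adde0 integral_h.
Qed.

End primitive.

Lemma Rintegral_cst_itv (r s t : R) : s <= t ->
  leb.-integrable `[s, t] (fun=> r%:E) /\ \int[leb]_(u in `[s, t]) r = r * (t - s).
Proof.
move=> st; have lst : leb `[s, t]%classic = (t - s)%:E.
  rewrite lebesgue_measure_itv /= lte_fin; case: ltP => [_|ts]; first by rewrite EFinB.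
  by have -> : t = s by [apply/eqP; rewrite eq_le ts st]; rewrite subrr.
split; last first.
  rewrite Rintegral_cst //.
  suff : r * fine (leb `[s, t]%classic) = r * (t - s) by [].
  by rewrite lst.
apply/integrableP; split=> //=.
rewrite integral_cst //.
suff : (`|r|%:E * leb `[s, t]%classic < +oo)%E by [].
by rewrite lst -EFinM ltry.
Qed.

(** Stein's identity for the function [z - m], whose derivative is 1. *)
Lemma normal_second_moment (m : R) :
  (normal_prob m 1).-integrable setT (fun z => ((z - m) ^+ 2)%:E) /\
  (\int[normal_prob m 1]_z ((z - m) ^+ 2)%:E = 1)%E.
Proof.
have ac (s t : R) : s <= t ->
    leb.-integrable `[s, t] (fun u : R => ((cst 1 : R -> R) u)%:E) /\
    (t - m) - (s - m) = \int[leb]_(u in `[s, t]) (cst 1 : R -> R) u.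
  move=> /(Rintegral_cst_itv 1)[i1 ->]; split=> //; ring.
have i1 : (normal_prob m 1).-integrable setT (EFin \o (cst 1 : R -> R)).
  exact: (finite_measure_integrable_cst (normal_prob m 1) 1).
have [iZ EZ] := stein_normal ac i1.
under eq_fun do rewrite expr2.
split=> //.
rewrite EZ /= integral_cst // mul1e; exact: (probability_setT (normal_prob m 1)).
Qed.

End stein_identity.

(** * Translation of null sets on the line *)

Section gaussian_translation.
Context {R : realType}.
Notation leb := (@lebesgue_measure R).

Lemma lebesgue_measure_translate (c : R) (A : set R) : measurable A ->
  leb ((fun u => u + c) @^-1` A) = leb A.
Proof.
move=> mA.
have mc : measurable_fun setT ((fun u => u + c) : measurableTypeR R -> measurableTypeR R).
  exact: measurable_funD.
pose nu : {measure set (measurableTypeR R) -> \bar R} :=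
  pushforward leb ((fun u => u + c) : measurableTypeR R -> measurableTypeR R).
apply/esym.
apply: (lebesgue_measure_unique (mu := nu mc)) => //= _ [[a b]] _ <-.
rewrite -[RHS]/(leb ((fun u => u + c) @^-1` `]a, b]%classic)).
have -> : (fun u => u + c) @^-1` `]a, b]%classic = `]a - c, b - c]%classic.
  by apply/seteqP; split => u /=; rewrite !in_itv /= ltrBlDr lerBrDr.
rewrite /= !lebesgue_measure_itv /= !lte_fin ltrD2r.
by case: ifP => // _; rewrite -!EFinB; congr (_%:E); ring.
Qed.

Lemma normal_prob_null (m : R) (A : set R) : measurable A ->
  normal_prob m 1 A = 0%E -> leb A = 0%E.
Proof.
move=> mA NA0.
have mp : measurable_fun A (fun x => (normal_pdf m 1 x)%:E).
  by apply/measurable_EFinP/measurable_funTS; exact: measurable_normal_pdf.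
have : (\int[leb]_(x in A) `|(normal_pdf m 1 x)%:E| = 0)%E.
  by rewrite -[RHS]NA0; apply: eq_integral => x _; rewrite gee0_abs // lee_fin normal_pdf_ge0.
move/(ae_eq_integral_abs leb mA mp) => [B [mB B0 AB]].
apply/eqP; rewrite eq_le measure_ge0 andbT -B0 le_measure ?inE //.
move=> x Ax; apply: AB => /= /(_ Ax) [] /eqP; apply/negP.
by rewrite gt_eqF // normal_pdf1E mulr_gt0 ?expR_gt0 // normal_peak_gt0 ?oner_neq0.
Qed.

(** Normal and Lebesgue null sets are the same, and Lebesgue measure is translation invariant. *)
Lemma normal_prob_translate_null (m c : R) (A : set R) : measurable A ->
  normal_prob m 1 A = 0%E -> normal_prob m 1 ((fun u => u + c) @^-1` A) = 0%E.
Proof.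
move=> mA /(normal_prob_null mA) lA.
have /null_content_dominatesP D := normal_prob_dominates m (1 : R).
apply: D; last by apply: etrans (lebesgue_measure_translate c mA) lA.
rewrite -[X in measurable X]setTI.
have mc : measurable_fun setT ((fun u => u + c) : measurableTypeR R -> measurableTypeR R).
  exact: measurable_funD.
exact: mc.
Qed.

End gaussian_translation.

(** * Null sets of the law of the random matrix *)

Section law_null_sets.
Context {R : realType} {n p : nat} {d : measure_display} {T : measurableType d}.
Variables (P : probability T R) (M : 'M[R]_(n, p)).
Variable X : 'I_n -> 'I_p -> {RV P >-> R}.
Hypothesis X_normal : independent_normal M X.
Notation BM := (borel_mx R n p).
Let Xm : T -> BM := random_mx X.

Definition law_null (B : set BM) : Prop := measurable B /\ P (Xm @^-1` B) = 0%E.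

Lemma law_aeP (Q : 'M[R]_(n, p) -> Prop) :
  law_ae X Q -> exists2 B : set BM, law_null B & forall x, ~ B x -> Q x.
Proof.
move=> [B [mB B0 QB]]; exists B => // x Bx.
by apply: contrapT => nQ; apply: Bx; exact: QB.
Qed.

Lemma law_null_ae (B : set BM) : law_null B -> {ae P, forall w, ~ B (Xm w)}.
Proof.
move=> [mB B0]; exists (Xm @^-1` B); split => //.
  exact: (measurable_preimage_random_mx X mB).
by move=> w /= /contrapT.
Qed.

Lemma law_nullU (A B : set BM) : law_null A -> law_null B -> law_null (A `|` B).
Proof.
move=> [mA A0] [mB B0]; split; first exact: measurableU.
have mXA := measurable_preimage_random_mx X mA.
have mXB := measurable_preimage_random_mx X mB.
rewrite preimage_setU; apply/measure_negligible; first exact: measurableU.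
by apply: negligibleU; apply/negligibleP.
Qed.

Lemma law_null_bigcup (B : nat -> set BM) :
  (forall k, law_null (B k)) -> law_null (\bigcup_k B k).
Proof.
move=> Bk; split; first by apply: bigcup_measurable => k _; case: (Bk k).
rewrite preimage_bigcup; apply/measure_negligible.
  apply: bigcup_measurable => k _.
  by have [mB _] := Bk k; exact: (measurable_preimage_random_mx X mB).
apply: negligible_bigcup => k; apply/negligibleP; last by case: (Bk k).
by have [mB _] := Bk k; exact: (measurable_preimage_random_mx X mB).
Qed.

Lemma measurable_mx_shift (v : 'M[R]_(n, p)) :
  measurable_fun [set: BM] (fun x : BM => (x + v : 'M[R]_(n, p)) : BM).
Proof.
apply: measurable_to_mx => a i; under eq_fun do rewrite mxE.
by apply: measurable_funD => //; exact: measurable_entry.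
Qed.

(** Resampling the entry [(a, i)] reduces this to a translation on almost every line. It is wanted
    for difference quotients, which evaluate a function at shifted points. *)
Lemma law_null_shift (B : set BM) (a : 'I_n) (i : 'I_p) (c : R) :
  law_null B -> law_null [set x : BM | B (x + c *: delta_mx a i : 'M[R]_(n, p))].
Proof.
move=> [mB B0].
have mB' : measurable [set x : BM | B (x + c *: delta_mx a i : 'M[R]_(n, p))].
  rewrite -[X in measurable X]setTI.
  exact: (measurable_mx_shift (c *: delta_mx a i) measurableT mB).
split=> //; rewrite -(resample_measure X_normal a i mB') /= /product_measure1.
have mU := measurable_mx_upd_random X a i.
set C := [set z | _].
have mC : measurable C by rewrite -[C]setTI; exact: (mU measurableT _ mB').
rewrite -[RHS](integral0 P setT); apply: ae_eq_integral => //.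
  exact: measurable_fun_xsection.
have := resample_ae X_normal a i mB B0; apply: filterS => w Nw _ /=.
pose S : set R := [set u | B (mx_upd a i u (Xm w))].
have mS : measurable (S : set (measurableTypeR R)).
  rewrite -[S]setTI.
  exact: (measurable_fun_pair2 w mU measurableT mB).
have -> : xsection C w = (fun u => u + c) @^-1` S.
  have E u : mx_upd a i u (Xm w) + c *: delta_mx a i = mx_upd a i (u + c) (Xm w).
    by rewrite !mx_updE -addrA -scalerDl addrAC.
  by apply/seteqP; split => u; rewrite /xsection /= inE /C /S /= E.
exact: normal_prob_translate_null.
Qed.

End law_null_sets.

Section integral_ae.
Context {d : measure_display} {T : measurableType d} {R : realType}.
Variable mu : {measure set T -> \bar R}.
Import HBNNSimple.
Local Open Scope ereal_scope.

(* The integral is a supremum over simple functions, so no measurability is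
   needed here. *)
Lemma ge0_integral_eq_ae (f g : T -> \bar R) :
  (forall x, 0 <= f x) -> (forall x, 0 <= g x) ->
  {ae mu, forall x, f x = g x} -> \int[mu]_x f x = \int[mu]_x g x.
Proof.
suff le (u v : T -> \bar R) : (forall x, 0 <= u x) -> (forall x, 0 <= v x) ->
    {ae mu, forall x, u x = v x} -> \int[mu]_x u x <= \int[mu]_x v x.
  move=> f0 g0 fg; apply/eqP; rewrite eq_le !le //.
  by apply: filterS fg => x ->.
move=> u0 v0 [N [mN N0 uvN]].
rewrite ge0_integralTE // [leRHS]ge0_integralTE //.
apply: ge_ereal_sup => _ [h hu <-].
(* Cutting [h] off the null set brings it below [v] everywhere without changing its integral. *)
pose k := mul_nnsfun h (indic_nnsfun R (measurableC mN)).
have kE x : k x = (h x * \1_(~` N) x)%R by [].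
apply: ereal_sup_ubound; exists k.
  move=> x; rewrite kE indicE; have [xN|xN] := boolP (x \in ~` N); last first.
    by rewrite mulr0 v0.
  rewrite mulr1 (le_trans (hu x)) //.
  suff -> : u x = v x by [].
  by apply: contrapT => uvx; move: xN; rewrite inE; apply; exact: uvN.
rewrite -!integralT_nnsfun; apply: ae_eq_integral => //.
- exact/measurable_EFinP.
- exact/measurable_EFinP.
exists N; split=> // x /= hk; apply: contrapT => xN; apply: hk => _.
apply: (congr1 EFin); apply: etrans (kE x) _.
by rewrite indicE mem_set // mulr1.
Qed.

Lemma ae_sub (Q Q' : T -> Prop) :
  {ae mu, forall x, Q x} -> (forall x, Q x -> Q' x) -> {ae mu, forall x, Q' x}.
Proof. by move=> aeQ QQ'; apply: filterS aeQ. Qed.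

Lemma integral_eq_ae (f g : T -> \bar R) :
  {ae mu, forall x, f x = g x} -> \int[mu]_x f x = \int[mu]_x g x.
Proof.
move=> fg; rewrite [LHS]integralE [RHS]integralE; congr (_ - _).
- by apply: ge0_integral_eq_ae => //; apply: filterS fg => x fg; rewrite !funeposE fg.
- by apply: ge0_integral_eq_ae => //; apply: filterS fg => x fg; rewrite !funenegE fg.
Qed.

End integral_ae.

Section translation_integral.
Context {R : realType}.
Notation leb := (@lebesgue_measure R).

(** [line_abs_continuous] measures the parameter from the current matrix, whereas resampling uses
    the value of the entry itself; the two differ by a translation. *)
Lemma integrable_translate (k : R -> R) (c s t : R) :
  leb.-integrable `[s + c, t + c] (EFin \o k) ->
  leb.-integrable `[s, t] (fun u => (k (u + c))%:E) /\
  \int[leb]_(u in `[s, t]) k (u + c) = \int[leb]_(u in `[s + c, t + c]) k u.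
Proof.
move=> ik.
pose k1 : R -> \bar R := (EFin \o k) \_ (`[s + c, t + c]%classic : set R).
pose sh : measurableTypeR R -> measurableTypeR R := fun u => u + c.
have msh : measurable_fun setT sh by exact: measurable_funD.
have ik1 : leb.-integrable setT k1.
  by rewrite -integrable_mkcond.
have mk1 : measurable_fun setT k1 by case/integrableP : ik1.
pose nu : {measure set (measurableTypeR R) -> \bar R} := pushforward leb sh.
have nuE (f : R -> \bar R) : (\int[nu msh]_u f u = \int[leb]_u f u)%E.
  by apply: eq_measure_integral => A mA _; exact: lebesgue_measure_translate.
have ik1s : leb.-integrable setT (k1 \o sh).
  apply/integrableP; split; first exact: measurableT_comp mk1 msh.
  have mak : measurable_fun setT (fun u => `|k1 u|)%E by exact: measurableT_comp.
  have := @ge0_integral_pushforward _ _ _ _ R sh msh leb setT _ measurableT mak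
    (fun u _ => abse_ge0 _).
  rewrite preimage_setT => /= <-.
  by rewrite nuE; case/integrableP : ik1.
have k1E u : (k1 \o sh) u = ((fun u => (k (u + c))%:E) \_ (`[s, t]%classic : set R)) u.
  rewrite /k1 /sh /= !patchE /= !mem_setE !in_itv /= !lerD2r.
  by [].
have k1E' : k1 \o sh = (fun u => (k (u + c))%:E) \_ (`[s, t]%classic : set R).
  by apply/funext.
split; first by rewrite integrable_mkcond // -k1E'.
rewrite /Rintegral; congr fine.
rewrite integral_mkcond -k1E' [RHS]integral_mkcond.
have := @integral_pushforward _ _ _ _ R sh msh leb setT _ mk1 ik1s measurableT.
by rewrite preimage_setT => <-; exact: nuE.
Qed.

End translation_integral.

(** * The risk *)

Section matrix_stein.
Context {R : realType} {n p : nat} {d : measure_display} {T : measurableType d}.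
Variables (P : probability T R) (M : 'M[R]_(n, p)).
Variable X : 'I_n -> 'I_p -> {RV P >-> R}.
Hypothesis X_normal : independent_normal M X.
Notation BM := (borel_mx R n p).
Notation leb := (@lebesgue_measure R).
Let Xm : T -> BM := random_mx X.

(** Off [B], the preimage of an open set agrees with its interior, which is a Borel set. *)
Lemma measurable_continuous_off (B : set BM) (f : 'M[R]_(n, p) -> R) :
  measurable B -> (forall x, ~ B x -> {for x, continuous f}) ->
  measurable_fun (~` B) (f : BM -> R).
Proof.
move=> mB cf; apply: (measurability _ (RGenOpens.measurableE R)).
move=> _ [_ [a [b ->]] <-].
set U := `]a, b[%classic.
have -> : ~` B `&` f @^-1` U = ~` B `&` (interior (f @^-1` U : set 'M[R]_(n, p)) : set BM).
  apply/seteqP; split => x [Bx fx]; split => //; last exact: interior_subset.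
  by apply: cf => //; apply: open_nbhs_nbhs; split => //; exact: interval_open.
apply: measurableI; first exact: measurableC.
by apply: sub_sigma_algebra; exact: open_interior.
Qed.

(** The derivative is a limit of difference quotients with steps [1 / (k + 1)]. The null set is
    enlarged by the corresponding shifts of [B], so that off it all the points involved avoid
    [B]. *)
Lemma measurable_derive_off (B : set BM) (f : 'M[R]_(n, p) -> R) (a : 'I_n) (i : 'I_p) :
  law_null X B -> (forall x, ~ B x -> differentiable f x) ->
  exists2 B' : set BM, law_null X B' & B `<=` B' /\
    measurable_fun (~` B') ('D_(delta_mx a i) f : BM -> R).
Proof.
move=> nB df; set v := delta_mx a i.
have mf : measurable_fun (~` B) (f : BM -> R).
  apply: measurable_continuous_off; first by case: nB.
  by move=> x Bx; exact/differentiable_continuous/df.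
pose c k : R := k.+1%:R^-1.
pose S k : set BM := [set x : BM | B (x + c k *: v : 'M[R]_(n, p))].
have nS k : law_null X (S k) by exact: (law_null_shift X_normal a i (c k) nB).
pose B' := B `|` \bigcup_k S k.
have nB' : law_null X B' by apply: law_nullU => //; exact: law_null_bigcup.
exists B' => //; split; first by move=> x Bx; left.
have mBC : measurable (~` B) by apply: measurableC; case: nB.
have mB'C : measurable (~` B') by apply: measurableC; case: nB'.
pose f1 : BM -> R := f \_ (~` B).
have mf1 : measurable_fun setT f1 by apply/(measurable_restrictT _ mBC).
refine (@measurable_fun_cvg _ BM R (~` B')
  (fun k x => (c k)^-1 * (f1 ((x : 'M[R]_(n, p)) + c k *: v : 'M[R]_(n, p)) - f1 x))
  ('D_v f) _ _).
  move=> k; apply: measurable_funTS; apply: measurable_funM => //.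
  apply: measurable_funB => //.
  exact: measurableT_comp mf1 (measurable_mx_shift (c k *: v)).
move=> x B'x; have Bx : ~ B x by move=> Bx; apply: B'x; left.
have -> : (fun k => (c k)^-1 * (f1 ((x : 'M[R]_(n, p)) + c k *: v : 'M[R]_(n, p)) - f1 x)) =
    (fun k => (c k)^-1 *: (f (c k *: v + x) - f x)).
  apply/funext => k; rewrite /f1 !patchE !mem_set //.
    by rewrite [_ + c k *: v]addrC.
  by move=> Bk; apply: B'x; right; exists k.
have /cvg_ex [l fl] : derivable f x v by apply: diff_derivable; exact: df.
have -> : 'D_v f x = l by apply: cvg_lim.
apply: (cvg_comp c _ _ fl) => A /= A0.
have c_cvg : c @ \oo --> (0 : R) by exact: cvg_harmonic.
have : \forall k \near \oo, c k != 0 -> A (c k) by exact: (c_cvg _ A0).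
by apply: filterS => k; apply; rewrite /c invr_neq0 // pnatr_eq0.
Qed.

Lemma line_abs_continuous_upd (f : 'M[R]_(n, p) -> R) (a : 'I_n) (i : 'I_p)
    (x : 'M[R]_(n, p)) :
  line_abs_continuous f (delta_mx a i) x -> forall s t : R, s <= t ->
  leb.-integrable `[s, t] (fun u => ('D_(delta_mx a i) f (mx_upd a i u x))%:E) /\
  f (mx_upd a i t x) - f (mx_upd a i s x) =
    \int[leb]_(u in `[s, t]) 'D_(delta_mx a i) f (mx_upd a i u x).
Proof.
move=> ac s t st; set v := delta_mx a i.
have st' : s - x a i <= t - x a i by rewrite lerD2r.
have [ik fE] := ac _ _ st'.
have [ik' kE] := integrable_translate ik.
have E u : 'D_v f (mx_upd a i u x) = 'D_v f (x + (u - x a i) *: v) by rewrite mx_updE.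
split.
  by apply: eq_integrable ik' => // u _; rewrite E.
rewrite !mx_updE fE -kE; apply: eq_Rintegral => u _.
by rewrite E.
Qed.

Lemma stein_mx_entry (f : 'M[R]_(n, p) -> R) (a : 'I_n) (i : 'I_p) (B : set BM) :
  law_null X B -> (forall x, ~ B x -> differentiable f x) ->
  law_ae X (line_abs_continuous f (delta_mx a i)) ->
  P.-integrable setT (fun w => ((X a i w - M a i) * f (Xm w))%:E) ->
  P.-integrable setT (fun w => ('D_(delta_mx a i) f (Xm w))%:E) ->
  (\int[P]_w ((X a i w - M a i) * f (Xm w))%:E =
   \int[P]_w ('D_(delta_mx a i) f (Xm w))%:E)%E.
Proof.
move=> nB df ac iZf iDf; set v := delta_mx a i.
have [B' nB' [BB' mDf]] := measurable_derive_off a i nB df.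
have mf : measurable_fun (~` B) (f : BM -> R).
  apply: measurable_continuous_off; first by case: nB.
  by move=> x Bx; exact/differentiable_continuous/df.
have mBC : measurable (~` B) by apply: measurableC; case: nB.
have mB'C : measurable (~` B') by apply: measurableC; case: nB'.
(* [F1] and [F2] are Borel versions of the two integrands, as resampling under the integral
   requires; they differ from them only on null sets. *)
pose F1 : 'M[R]_(n, p) -> R := ('D_v f : BM -> R) \_ (~` B').
pose F2 (x : 'M[R]_(n, p)) : R := (x a i - M a i) * ((f : BM -> R) \_ (~` B)) x.
have mF1 : measurable_fun [set: BM] (F1 : BM -> R) by apply/(measurable_restrictT _ mB'C).
have mF2 : measurable_fun [set: BM] (F2 : BM -> R).
  apply: measurable_funM; last by apply/(measurable_restrictT _ mBC).
  by apply: measurable_funB => //; exact: measurable_entry.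
have mX := measurable_random_mx X.
have iF1 : P.-integrable setT (fun w => (F1 (Xm w))%:E).
  apply: le_integrable iDf => //.
    by apply/measurable_EFinP; exact: measurableT_comp mF1 mX.
  move=> w _; rewrite lee_fin /F1 patchE; case: ifPn => // _.
  by rewrite normr0.
have iF2 : P.-integrable setT (fun w => (F2 (Xm w))%:E).
  apply: le_integrable iZf => //.
    by apply/measurable_EFinP; exact: measurableT_comp mF2 mX.
  move=> w _; rewrite lee_fin /F2 patchE {1}/Xm mxE; case: ifPn => // _.
  by rewrite mulr0 normr0.
have E1 : (\int[P]_w (F1 (Xm w))%:E = \int[P]_w ('D_v f (Xm w))%:E)%E.
  apply: integral_eq_ae; apply: filterS (law_null_ae nB') => w Bw.
  by rewrite /F1 patchE mem_set.
have E2 : (\int[P]_w (F2 (Xm w))%:E = \int[P]_w ((X a i w - M a i) * f (Xm w))%:E)%E.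
  apply: integral_eq_ae; apply: filterS (law_null_ae nB) => w Bw.
  by rewrite /F2 patchE mem_set // {1}/Xm mxE.
rewrite -E1 -E2.
have [iU1 ->] := resample_integral X_normal a i mF1 iF1.
have [iU2 ->] := resample_integral X_normal a i mF2 iF2.
apply: integral_eq_ae.
pose N : probability (measurableTypeR R) R := normal_prob (M a i) 1.
have [C nC acC] := law_aeP ac.
have aeC := law_null_ae nC.
have aeB : {ae P, forall w, N [set u | B (mx_upd a i u (Xm w))] = 0%E}.
  by case: nB => mB B0; exact: resample_ae.
have aeB' : {ae P, forall w, N [set u | B' (mx_upd a i u (Xm w))] = 0%E}.
  by case: nB' => mB B0; exact: resample_ae.
have aeI1 := ae_integrable1 iU1.
have mU := measurable_mx_upd_random X a i.
have mS (A : set BM) w : measurable A ->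
    measurable ([set u | A (mx_upd a i u (Xm w))] : set (measurableTypeR R)).
  move=> mA; rewrite -[X in measurable X]setTI.
  exact: (measurable_fun_pair2 w mU measurableT mA).
near=> w.
have Cw : ~ C (Xm w) by near: w.
have Bw : N [set u | B (mx_upd a i u (Xm w))] = 0%E by near: w.
have B'w : N [set u | B' (mx_upd a i u (Xm w))] = 0%E by near: w.
have I1w : N.-integrable setT (fun u => (F1 (mx_upd a i u (Xm w)))%:E).
  by near: w.
have aeuB : {ae N, forall u, ~ B (mx_upd a i u (Xm w))}.
  exists [set u | B (mx_upd a i u (Xm w))]; split => //; first by apply: mS; case: nB.
  by move=> u /= /contrapT.
have aeuB' : {ae N, forall u, ~ B' (mx_upd a i u (Xm w))}.
  exists [set u | B' (mx_upd a i u (Xm w))]; split => //; first by apply: mS; case: nB'.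
  by move=> u /= /contrapT.
have acw := line_abs_continuous_upd (acC _ Cw).
pose f' u := 'D_v f (mx_upd a i u (Xm w)).
(* Absolute continuity makes [f'] integrable, hence measurable, on each interval from [-k] to [k],
   and these exhaust the line. *)
have mf' : measurable_fun [set: R] f'.
  rewrite -(bigcup_itvT true false); apply/measurable_fun_bigcup => // k.
  have [|ik _] := acw (- k%:R) k%:R; first by rewrite (le_trans (y := 0)) ?oppr_le0 ?ler0n.
  by apply/measurable_EFinP; case/integrableP : ik.
have aeF1 : {ae N,
    forall u, (F1 (mx_upd a i u (Xm w)))%:E = (f' u)%:E}.
  by apply: (ae_sub aeuB') => u Bu; rewrite /F1 patchE mem_set.
(* Global integrability comes from Fubini's theorem for [F1], with which [f'] agrees almost
   everywhere on this line. *)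
have if' : N.-integrable setT (EFin \o f').
  apply/integrableP; split; first exact/measurable_EFinP.
  have [_] := integrableP _ _ _ I1w; congr (_ < +oo)%E; apply: integral_eq_ae.
  by apply: (ae_sub aeF1) => u E; rewrite E.
have [_ ZE] := stein_normal acw if'.
transitivity (\int[N]_u (f' u)%:E)%E; last first.
  by apply: integral_eq_ae; apply: (ae_sub aeF1) => u E; rewrite E.
rewrite -ZE; apply: integral_eq_ae; apply: (ae_sub aeuB) => u Bu.
by rewrite /F2 patchE mem_set // mxE !eqxx.
Unshelve. all: by end_near. Qed.

End matrix_stein.

(** * Moments of the centred entries *)

Section risk.
Context {R : realType} {n p : nat} {d : measure_display} {T : measurableType d}.
Variables (P : probability T R) (M : 'M[R]_(n, p)).
Variable X : 'I_n -> 'I_p -> {RV P >-> R}.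
Hypothesis X_normal : independent_normal M X.
Notation BM := (borel_mx R n p).
Notation leb := (@lebesgue_measure R).

Lemma integrable_mul_sqr (u v : T -> R) :
  measurable_fun [set: T] u -> measurable_fun [set: T] v ->
  P.-integrable setT (fun w => (u w ^+ 2)%:E) ->
  P.-integrable setT (fun w => (v w ^+ 2)%:E) ->
  P.-integrable setT (fun w => (u w * v w)%:E).
Proof.
move=> mu mv iu iv; apply: le_integrable (integrableD measurableT iu iv) => //.
  by apply/measurable_EFinP; exact: measurable_funM.
move=> w _; rewrite /= lee_fin.
rewrite [leRHS]ger0_norm ?addr_ge0 ?sqr_ge0 // ler_norml; apply/andP; split; nra.
Qed.

Lemma integrable_center_sqr (a : 'I_n) (i : 'I_p) :
  P.-integrable setT (fun w => ((X a i w - M a i) ^+ 2)%:E).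
Proof.
have [_ distr] := X_normal.
have [/integrableP[mq q_lty] _] := normal_second_moment (M a i).
have mX : measurable_fun [set: T] (X a i) by exact: measurable_funPT.
apply/integrableP; split.
  by apply/measurable_EFinP; apply: measurable_funX; exact: measurable_funB.
move: q_lty; congr (_ < +oo)%E.
pose N : probability (measurableTypeR R) R := normal_prob (M a i) 1.
pose phi : T -> measurableTypeR R := X a i.
have mphi : measurable_fun setT phi by exact: mX.
pose q : measurableTypeR R -> \bar R := fun z => `|((z - M a i) ^+ 2)%:E|%E.
have mq' : measurable_fun setT q by exact: measurableT_comp.
have := @ge0_integral_pushforward _ _ _ _ R phi mphi P setT q measurableT mq'
  (fun z _ => abse_ge0 _).
rewrite preimage_setT => <-.
pose nu : {measure set (measurableTypeR R) -> \bar R} := pushforward P phi.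
refine (@eq_measure_integral _ (measurableTypeR R) R setT (nu mphi) N _ _).
by move=> A mA _; apply/esym; exact: distr.
Qed.

Lemma law_null_set0 : law_null X set0.
Proof. by split; [exact: measurable0|rewrite preimage_set0 measure0]. Qed.

Lemma law_ae_all (Q : 'M[R]_(n, p) -> Prop) : (forall x, Q x) -> law_ae X Q.
Proof.
move=> allQ; exists set0; split; first exact: measurable0.
  by rewrite /pushforward preimage_set0 measure0.
by move=> x /= nQ; apply: nQ.
Qed.

Lemma derive_center (a : 'I_n) (i j : 'I_p) (x : 'M[R]_(n, p)) :
  'D_(delta_mx a i) (fun x : 'M[R]_(n, p) => x a j - M a j) x = (i == j)%:R.
Proof.
have dc : differentiable (fun x : 'M[R]_(n, p) => x a j : R) x.
  exact: differentiable_coord.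
rewrite deriveB; [|exact: diff_derivable|exact: derivable_cst].
rewrite derive_cst subr0 derive_entry // derive_id !mxE eqxx /=.
by rewrite eq_sym.
Qed.

(** Stein's identity for the function [x a j - M a j], whose derivative in the entry [(a, i)] is 1
    or 0; variances and covariances are thus treated together. *)
Lemma covariance_center (a : 'I_n) (i j : 'I_p) :
  (\int[P]_w ((X a i w - M a i) * (X a j w - M a j))%:E = ((i == j)%:R)%:E)%E.
Proof.
pose f (x : 'M[R]_(n, p)) : R := x a j - M a j.
have mX b k : measurable_fun [set: T] (X b k) by exact: measurable_funPT.
have iZ : P.-integrable setT (fun w => ((X a i w - M a i) * f (random_mx X w))%:E).
  under eq_fun do rewrite /f mxE.
  by apply: integrable_mul_sqr; [exact: measurable_funB|exact: measurable_funB
    |exact: integrable_center_sqr|exact: integrable_center_sqr].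
have ac x : line_abs_continuous f (delta_mx a i) x.
  move=> s t /(Rintegral_cst_itv (i == j)%:R)[ic cE].
  have E u : 'D_(delta_mx a i) f (x + u *: delta_mx a i) = (i == j)%:R.
    exact: derive_center.
  split; first by apply: eq_integrable ic => // u _; rewrite E.
  rewrite /f !mxE eqxx /= [j == i]eq_sym.
  transitivity ((i == j)%:R * (t - s) : R); first by ring.
  by rewrite -cE; apply: eq_Rintegral => u _; rewrite E.
transitivity (\int[P]_w ((X a i w - M a i) * f (random_mx X w))%:E)%E.
  by apply: eq_integral => w _; rewrite /f mxE.
rewrite (stein_mx_entry X_normal law_null_set0 _ _ iZ).
- under eq_integral do rewrite derive_center.
  rewrite integral_cst //.
  by rewrite [X in (_ * X)%E](@probability_setT _ _ _ P) mule1.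
- by move=> x _; apply: differentiableB => //; exact: differentiable_coord.
- exact: law_ae_all.
- under eq_fun do rewrite derive_center.
  exact: (finite_measure_integrable_cst P).
Qed.

Lemma integralD4 (u1 u2 u3 u4 : T -> R) :
  P.-integrable setT (EFin \o u1) -> P.-integrable setT (EFin \o u2) ->
  P.-integrable setT (EFin \o u3) -> P.-integrable setT (EFin \o u4) ->
  P.-integrable setT (fun w => (u1 w + u2 w + u3 w + u4 w)%:E) /\
  (\int[P]_w (u1 w + u2 w + u3 w + u4 w)%:E =
   \int[P]_w (u1 w)%:E + \int[P]_w (u2 w)%:E + \int[P]_w (u3 w)%:E
   + \int[P]_w (u4 w)%:E)%E.
Proof.
move=> i1 i2 i3 i4.
have i12 : P.-integrable setT (EFin \o (u1 \+ u2)) := integrableD measurableT i1 i2.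
have i123 : P.-integrable setT (EFin \o (u1 \+ u2 \+ u3)) :=
  integrableD measurableT i12 i3.
split; first exact: (integrableD measurableT i123 i4).
rewrite -(integralD measurableT i1 i2) -(integralD measurableT i12 i3).
by rewrite -(integralD measurableT i123 i4).
Qed.

End risk.

(** * Expansion of the quadratic loss *)

Section risk_identity.
Context {R : realType} {n p : nat} {d : measure_display} {T : measurableType d}.
Variables (P : probability T R) (M : 'M[R]_(n, p)).
Variable X : 'I_n -> 'I_p -> {RV P >-> R}.
Hypothesis X_normal : independent_normal M X.
Variable g : 'M[R]_(n, p) -> 'M[R]_(n, p).
Hypothesis g_diff : law_ae X (fun x => differentiable g x).
Hypothesis g_weak : weakly_differentiable X g.
Hypothesis g_L2 : forall (a : 'I_n) (i : 'I_p),
  (fun w => g (random_mx X w) a i) \in Lfun P 2%:E.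
Hypothesis Dg_L1 : forall (a : 'I_n) (i j : 'I_p),
  (fun w => 'D_(delta_mx a i) (fun x : 'M[R]_(n, p) => g x a j) (random_mx X w))
    \in Lfun P 1%E.
Local Notation Z a i w := (X a i w - M a i).
Local Notation G a i w := (g (random_mx X w) a i).
Local Notation DG a i j w :=
  ('D_(delta_mx a i) (fun x : 'M[R]_(n, p) => g x a j) (random_mx X w)).

Let measurable_g (a : 'I_n) (i : 'I_p) : measurable_fun [set: T] (fun w => G a i w).
Proof. by have := g_L2 a i; rewrite inE => /andP[]; rewrite inE. Qed.

Let integrable_g_sqr (a : 'I_n) (i : 'I_p) :
  P.-integrable setT (fun w => (G a i w ^+ 2)%:E).
Proof. exact: Lfun2_integrable_sqr (g_L2 a i). Qed.

Let measurable_center (a : 'I_n) (i : 'I_p) : measurable_fun [set: T] (fun w => Z a i w).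
Proof. by apply: measurable_funB => //; exact: measurable_funPT. Qed.

Let integrable_Zg (a : 'I_n) (i j : 'I_p) :
  P.-integrable setT (fun w => (Z a i w * G a j w)%:E).
Proof.
by apply: integrable_mul_sqr => //; exact: (integrable_center_sqr X_normal).
Qed.

Let integrable_Dg (a : 'I_n) (i j : 'I_p) : P.-integrable setT (fun w => (DG a i j w)%:E).
Proof. exact/Lfun1_integrable/Dg_L1. Qed.

Let stein_g (a : 'I_n) (i j : 'I_p) :
  (\int[P]_w (Z a i w * G a j w)%:E = \int[P]_w (DG a i j w)%:E)%E.
Proof.
have [B nB dg] := law_aeP g_diff.
apply: (stein_mx_entry X_normal nB) => //.
move=> x Bx; apply: (differentiable_comp (g := fun y : 'M[R]_(n, p) => y a j)).
  exact: dg.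
exact: differentiable_coord.
Qed.

Let risk_row (a : 'I_n) (i j : 'I_p) :
  P.-integrable setT (fun w => ((Z a i w + G a i w) * (Z a j w + G a j w))%:E) /\
  P.-integrable setT (fun w => (DG a i j w + DG a j i w + G a i w * G a j w)%:E) /\
  (\int[P]_w ((Z a i w + G a i w) * (Z a j w + G a j w))%:E =
   ((i == j)%:R)%:E +
   \int[P]_w (DG a i j w + DG a j i w + G a i w * G a j w)%:E)%E.
Proof.
have iZZ : P.-integrable setT (fun w => (Z a i w * Z a j w)%:E).
  by apply: integrable_mul_sqr => //; exact: (integrable_center_sqr X_normal).
have iGG : P.-integrable setT (fun w => (G a i w * G a j w)%:E).
  by apply: integrable_mul_sqr.
(* Pads the three terms of the right-hand side to the four of [integralD4]. *)
have i0 : P.-integrable setT (fun w => (0 : R)%:E).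
  exact: (finite_measure_integrable_cst P 0).
have [i1 E1] := integralD4 iZZ (integrable_Zg a i j) (integrable_Zg a j i) iGG.
have [i2 E2] := integralD4 i0 (integrable_Dg a i j) (integrable_Dg a j i) iGG.
have F1 w : (Z a i w + G a i w) * (Z a j w + G a j w) =
    Z a i w * Z a j w + Z a i w * G a j w + Z a j w * G a i w + G a i w * G a j w.
  by ring.
have F2 w : DG a i j w + DG a j i w + G a i w * G a j w =
    0 + DG a i j w + DG a j i w + G a i w * G a j w by rewrite add0r.
split; first by apply: eq_integrable i1 => // w _; rewrite F1.
split; first by apply: eq_integrable i2 => // w _; rewrite F2.
under eq_integral do rewrite F1.
under [in RHS]eq_integral do rewrite F2.
rewrite E1 E2 (covariance_center X_normal) !stein_g integral0 add0e.
by rewrite !addeA.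
Qed.

Lemma matrix_risk_identity (i j : 'I_p) :
  (\int[P]_w (mxqloss M (random_mx X w + g (random_mx X w)) i j)%:E =
   ((n%:R : R)%:M i j)%:E +
   \int[P]_w (\sum_a (DG a i j w + DG a j i w + G a i w * G a j w))%:E)%E.
Proof.
transitivity (\int[P]_w \sum_(a < n) ((Z a i w + G a i w) * (Z a j w + G a j w))%:E)%E.
  apply: eq_integral => w _; rewrite sumEFin; congr EFin.
  by rewrite /mxqloss !mxE; apply: eq_bigr => a _; rewrite !mxE; ring.
rewrite integral_sum //; last by move=> a; case: (risk_row a i j).
under eq_bigr => a _ do rewrite (risk_row a i j).2.2.
rewrite big_split /= sumEFin; congr (_%:E + _)%E.
  by rewrite sumr_const card_ord !mxE -mulrnA mulnC mulrnA.
under [in RHS]eq_integral do rewrite -sumEFin.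
by rewrite integral_sum // => a; case: (risk_row a i j) => _ [].
Qed.

End risk_identity.

Theorem theorem3p1 (R : realType) (n p : nat)
    (d : measure_display) (T : measurableType d) (P : probability T R)
    (M : 'M[R]_(n, p)) (X : 'I_n -> 'I_p -> {RV P >-> R})
    (h : 'M[R]_(n, p) -> R) (H : 'rV[R]_p -> R)
    (lam : 'M[R]_(n, p) -> 'rV[R]_p) (V : 'M[R]_(n, p) -> 'M[R]_p)
    (X_normal : independent_normal M X)
    (h_inv : orthogonally_invariant h)
    (spectral : forall x : 'M[R]_(n, p), spectral_decomposition (x^T *m x) (V x) (lam x))
    (h_eq : forall x : 'M[R]_(n, p), h x = H (lam x))
    (h_diff2 : law_ae X (twice_differentiable h))
    (grad_weak : weakly_differentiable X (mgrad h))
    (grad_L2 : forall (a : 'I_n) (i : 'I_p),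
       (fun w => mgrad h (random_mx X w) a i) \in Lfun P 2%:E)
    (hess_L1 : forall (a : 'I_n) (i j : 'I_p),
       (fun w => 'D_(delta_mx a i) (fun x : 'M[R]_(n, p) => mgrad h x a j) (random_mx X w))
         \in Lfun P 1%E) :
  let Mhat (x : 'M[R]_(n, p)) := x + mgrad h x in
  let D (x : 'M[R]_(n, p)) := diag_mx (Ddiag n H (lam x)) in
  forall i j : 'I_p,
    ('E_P[fun w => mxqloss M (Mhat (random_mx X w)) i j] =
     ((n%:R : R)%:M i j)%:E
     + 'E_P[fun w => let x := random_mx X w in
                     (V x *m D x *m (V x)^T) i j])%E.
Proof.
move=> Mhat D i j.
have g_diff : law_ae X (fun x => differentiable (mgrad h) x).
  by apply: (ae_sub h_diff2); [exact: measurable_random_mx|move=> x []].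
rewrite unlock (matrix_risk_identity X_normal g_diff grad_weak grad_L2 hess_L1).
(* It remains to identify the integrands where [h] is twice differentiable and [gram_disc] is
   nonzero, an event of probability one. *)
congr (_ + _)%E; apply: integral_eq_ae.
have [B nB d2] := law_aeP h_diff2.
have aeB := law_null_ae nB.
have aeD := gram_disc_neq0_ae X_normal.
apply: filterS2 aeB aeD => w Bw Dw; congr EFin => /=.
have [_ dg] := d2 _ Bw.
(* The hypotheses differentiate each entry of the gradient, [stein_mx] the gradient as a matrix;
   [derive_entry] reconciles them where the gradient is differentiable. *)
rewrite -(stein_mx_spectral h_inv spectral h_eq (d2 _ Bw) Dw) /stein_mx !mxE.
rewrite -!big_split /=; apply: eq_bigr => a _; rewrite !derive_entry //.
by rewrite !mxE.
Qed.
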